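(* Let $k\ge 1$ and $m_1,\dots,m_k\ge 1$ be integers. Let $G^a_k$ be the caterpillar graph with central path $v_1v_2\cdots v_{2k-1}$ such that $v_{2i-1}$ has $m_i$ legs for $i=1,\dots,k$ and $v_2,v_4,\dots,v_{2k-2}$ have no legs (degree 2). Then \[ M(G^a_k)\simeq \bigvee_{L_k(a_1,\dots,a_k)} S^{k-1}, \] a wedge of $L_k(a_1,\dots,a_k)$ copies of $S^{k-1}$, where $a_i=m_i-1$.
   Context: For a finite simple graph $G$, the matching complex $M(G)$ is the simplicial complex whose vertex set is $E(G)$ and whose faces are the matchings of $G$ (sets of pairwise vertex-disjoint edges). A caterpillar graph is a tree in which every vertex lies on a central path or is adjacent to it; a leg at a central vertex is a pendant leaf attached to it. For variables $a_1,\dots,a_k$, \[ L_k(a_1,\dots,a_k)=\sum_{\ell=1}^{k}\ \sum_{1\le i_1<\cdots<i_\ell\le k}(i_2-i_1)\cdots(i_\ell-i_{\ell-1})\,a_{i_1}\cdots a_{i_\ell}, \] the product of differences being $1$ when $\ell=1$. *)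

(* Defs.v *)
From HB Require Import structures.
From mathcomp Require Import all_boot all_order all_algebra.
From mathcomp Require Import all_classical all_reals all_analysis.
From mathcomp Require Import homotopy.

Set Implicit Arguments.
Unset Strict Implicit.
Unset Printing Implicit Defensive.

Import Order.TTheory GRing.Theory Num.Theory.
Import numFieldNormedType.Exports.

Local Open Scope classical_set_scope.
Local Open Scope ring_scope.

Record sgraph := SGraph {
  vertex :> finType;
  adj : rel vertex;
  adj_sym : symmetric adj;
  adj_irr : irreflexive adj }.

Definition is_edge (G : sgraph) (e : {set G}) : bool :=
  [exists x, exists y, adj x y && (e == [set x; y]%SET)].

Definition edge (G : sgraph) : finType := {e : {set G} | is_edge e}.

(* The empty set is a face; this does not affect the geometric realization. *)
Record scomplex (V : finType) := SComplex {
  face : {set V} -> bool;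
  face_sub : forall s t : {set V}, t \subset s -> face s -> face t;
  face_vertex : forall v : V, face [set v]%SET }.

Definition matching (G : sgraph) (M : {set edge G}) : bool :=
  [forall e in M, forall f in M, (e != f) ==> [disjoint val e & val f]].

Lemma matching_sub (G : sgraph) (M N : {set edge G}) :
  N \subset M -> matching M -> matching N.
Proof.
move=> /fintype.subsetP NM /forall_inP hM; apply/forall_inP => e eN.
apply/forall_inP => f fN; have /forall_inP := hM _ (NM _ eN).
by apply; exact: NM.
Qed.

Lemma matching1 (G : sgraph) (e : edge G) : matching [set e]%SET.
Proof.
apply/forall_inP => f; rewrite inE => /eqP->.
by apply/forall_inP => g; rewrite inE => /eqP->; rewrite eqxx.
Qed.

Definition matching_complex (G : sgraph) : scomplex (edge G) :=
  SComplex (@matching_sub G) (@matching1 G).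

(* Points are given by their barycentric coordinates. As [V] is finite, the
   product topology on [V -> R] induces the usual topology on the realization. *)
Definition realization_set (R : realType) (V : finType) (K : scomplex V) :
    set {ptws V -> R} :=
  [set x | [/\ forall v, 0 <= x v, \sum_v x v = 1
             & face K [set v | x v != 0]%SET]].

Definition realization (R : realType) (V : finType) (K : scomplex V) :
  topologicalType := @realization_set R V K.

(* The central path is [inl 0, ..., inl n.-1], and [inr (existT _ p j)] is the
   [j]-th leg at [inl p]. *)
Section Caterpillar.
Variables (n : nat) (legs : 'I_n -> nat).

Definition caterpillar_vertex : finType := ('I_n + {p : 'I_n & 'I_(legs p)})%type.

Definition caterpillar_adj (x y : caterpillar_vertex) : bool :=
  match x, y with
  | inl p, inl q => (p.+1 == q :> nat) || (q.+1 == p :> nat)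
  | inl p, inr l => tag l == p
  | inr l, inl p => tag l == p
  | inr _, inr _ => false
  end.

Lemma caterpillar_adj_sym : symmetric caterpillar_adj.
Proof. by move=> [p|l] [q|l'] //=; rewrite orbC. Qed.

Lemma caterpillar_adj_irr : irreflexive caterpillar_adj.
Proof. by move=> [p|l] //=; rewrite orbb gtn_eqF. Qed.

Definition caterpillar : sgraph := SGraph caterpillar_adj_sym caterpillar_adj_irr.
End Caterpillar.

(* Indices are shifted to start at 0: the central vertex [v_(p+1)] is [inl p],
   so the vertex [v_(2i-1)], which carries [m_i] legs, becomes
   [inl (2 * i)] with [m i] legs, for [i : 'I_k]. *)
Definition legs_a (k : nat) (m : 'I_k -> nat) (p : 'I_(k.*2.-1)) : nat :=
  if odd p then 0%N else oapp m 0%N (insub p./2).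

Definition graph_a (k : nat) (m : 'I_k -> nat) : sgraph := caterpillar (legs_a m).

(* The index sequences [i_1 < ... < i_l] are the strictly increasing [l]-tuples.
   The subtractions are never truncated on these. *)
Definition Lpoly (k : nat) (a : 'I_k -> nat) : nat :=
  (\sum_(1 <= l < k.+1) \sum_(t : l.-tuple 'I_k | sorted ltn (map val t))
     (\prod_(0 <= j < l.-1) (nth 0 (map val t) j.+1 - nth 0 (map val t) j)) *
     \prod_(i <- t) a i)%N.

Definition sphere_set (R : realType) (d : nat) : set 'rV[R]_d.+1 :=
  [set x | \sum_i x 0 i ^+ 2 = 1].

Definition sphere (R : realType) (d : nat) : topologicalType := @sphere_set R d.

Lemma sphere_base_subproof (R : realType) (d : nat) :
  delta_mx 0 0 \in @sphere_set R d.
Proof.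
rewrite inE /sphere_set /= (bigD1 ord0) //= big1 ?addr0 ?mxE ?eqxx ?expr1n //.
by move=> i /negbTE i0; rewrite mxE i0 andbF expr0n.
Qed.

Definition sphere_base (R : realType) (d : nat) : sphere R d :=
  exist _ (delta_mx 0 0) (sphere_base_subproof R d).

(* The library's [wedge] over an empty index type is empty, whereas a wedge of
   no pointed spaces is a point; hence the case distinction. *)
Definition wedge_copies (n : nat) (X : topologicalType) (x0 : X) :
    topologicalType :=
  if n is 0%N then discrete_topology unit else wedge (fun _ : 'I_n => x0).

Definition homotopic (R : realType) (X Y : topologicalType) (f g : X -> Y) :
    Prop :=
  exists H : X * R -> Y,
    [/\ {within [set: X] `*` `[0, 1], continuous H},
        forall x, H (x, 0) = f x & forall x, H (x, 1) = g x].

Definition homotopy_equivalent (R : realType) (X Y : topologicalType) : Prop :=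
  exists (f : X -> Y) (g : Y -> X),
    [/\ continuous f, continuous g,
        homotopic R (g \o f) idfun & homotopic R (f \o g) idfun].

(* Main.v *)
(* Group the edges of the graph into the cliques of edges at v_1, v_3, ...: a
   face of the matching complex is a partial word with at most one letter in
   each position, in which the edge from v_(2i-1) to v_2i is never followed by
   the edge from v_2i to v_(2i+1). Let z_i be a chosen leg in position i. Adding
   z_i to a face with no letter in position i gives again a face, so the points
   that carry no mass off z_i in some position i form a subcomplex A that is
   contractible in itself: it is the union of the stars of the z_i, and the
   intersections of these stars are cones. The complement of A consists of the interiors of
   the facets avoiding all z_i. An explicit homotopy of the whole complex that
   preserves A and shrinks A to a point shows that the complex is equivalent to
   its quotient by A, a wedge of (k-1)-spheres. A transfer recursion shows that
   the number of words avoiding all z_i is L_k. *)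
Require Import Defs.
From mathcomp Require Import all_boot all_order all_algebra.
From mathcomp Require Import all_classical all_reals all_analysis.
From mathcomp Require Import homotopy ring lra zify.

Set Implicit Arguments.
Unset Strict Implicit.
Unset Printing Implicit Defensive.

Local Open Scope nat_scope.

(** * Counting words *)

Lemma sum_tupleS (A : finType) n (F : n.+1.-tuple A -> nat) :
  \sum_t F t = \sum_x \sum_(t : n.-tuple A) F [tuple of x :: t].
Proof.
rewrite pair_big /=; apply: (reindex (fun p : A * n.-tuple A => [tuple of p.1 :: p.2])).
exists (fun t => (thead t, [tuple of behead t])) => [[x t] _|t _] /=.
  by rewrite theadE; congr (_, _); apply/val_inj.
by rewrite -tuple_eta.
Qed.

(* A letter [None] stands for a leg, [Some true] for the path edge to the right
   and [Some false] for the path edge to the left. *)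
Definition follows (x y : option bool) : bool :=
  ~~ ((x == Some true) && (y == Some false)).

(** The letter [x] stands in front of the word. With [x = Some true] the word cannot begin with a
    left edge, which the first centre lacks; the condition on the last letter excludes the missing
    right edge of the last centre. *)
Definition good_word (x : option bool) (s : seq (option bool)) : bool :=
  path follows x s && (last x s != Some true).

Definition letter_weight (a : nat -> nat) (i : nat) (x : option bool) : nat :=
  if x is None then a i else 1.

(** Weighted count of the words of length [n] that can follow the letter [x] from position [i] on; a
    leg in position [j] stands for [a j] different edges. *)
Definition word_sum (a : nat -> nat) n x i : nat :=
  \sum_(t : n.-tuple (option bool))
    good_word x t * \prod_(j < n) letter_weight a (i + j) (nth None t j).

Lemma word_sum0 a x i : word_sum a 0 x i = (x != Some true).
Proof.
rewrite /word_sum (eq_bigr (fun=> (x != Some true : nat))) => [|t _].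
  by rewrite sum_nat_const card_tuple mul1n.
by rewrite tuple0 big_ord0 muln1.
Qed.

Lemma word_sumS a n x i : word_sum a n.+1 x i =
  \sum_y follows x y * letter_weight a i y * word_sum a n y i.+1.
Proof.
rewrite /word_sum sum_tupleS; apply: eq_bigr => y _.
rewrite big_distrr; apply: eq_bigr => t _ /=.
rewrite /good_word /= big_ord_recl addn0 /=.
under eq_bigr do rewrite add0n /bump /= add1n addnS -addSn.
by rewrite -andbA -mulnb; ring.
Qed.

Lemma word_sum_Some_false a n i :
  word_sum a n (Some false) i = word_sum a n None i.
Proof. by case: n => [|n]; rewrite ?word_sum0 ?word_sumS. Qed.

Lemma big_option_bool (F : option bool -> nat) :
  \sum_x F x = F None + F (Some true) + F (Some false).
Proof.
rewrite (bigD1 None) // (bigD1 (Some true)) // (bigD1 (Some false)) //=.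
by rewrite big_pred0 => [|[[]|]]; rewrite ?addn0 ?addnA.
Qed.

(** * Closed form of the transfer recursion *)

Section SuffixSums.
Variables (k : nat) (a V Q : nat -> nat).
Hypothesis Vk : V k = 1.
Hypothesis Qk : Q k = 0.
Hypothesis VE : forall i, i < k -> V i = V i.+1 + Q i.
Hypothesis QE : forall i, i < k -> Q i = a i * V i.+1 + Q i.+1.

(** Telescoping [QE] down from [k] gives the first sum. By [VE], [V i] is 1 plus the sum of all [Q]
    from [i] on, and [a j * V j.+1] occurs in [Q i], ..., [Q j], that is [j.+1 - i] times. *)
Lemma suffix_sums n : n <= k ->
  Q (k - n) = \sum_(k - n <= j < k) a j * V j.+1 /\
  V (k - n) = 1 + \sum_(k - n <= j < k) (j.+1 - (k - n)) * (a j * V j.+1).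
Proof.
elim: n => [|n ihn] nk; first by rewrite subn0 !big_geq ?Vk ?Qk.
have [ihQ ihV] := ihn (ltnW nk).
have i1 : (k - n.+1).+1 = k - n by lia.
have ik : k - n.+1 < k by lia.
rewrite -i1 in ihQ ihV; move: (k - n.+1) ik ihQ ihV => p pk ihQ ihV.
have -> : \sum_(p <= j < k) (j.+1 - p) * (a j * V j.+1) =
    \sum_(p <= j < k) a j * V j.+1 + \sum_(p.+1 <= j < k) (j.+1 - p.+1) * (a j * V j.+1).
  rewrite !(big_ltn pk) subSnn mul1n -addnA -big_split /=; congr (_ + _).
  apply: eq_big_nat => j /andP[pj _]; rewrite -mulSn; congr (_ * _); lia.
have Qp : Q p = \sum_(p <= j < k) a j * V j.+1 by rewrite QE // ihQ (big_ltn pk).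
by rewrite VE // Qp ihV; split=> //; rewrite -addnA (addnC (\sum_(p <= j < k) _)).
Qed.

(** By [suffix_sums] the shifted sequence [V i.+1] obeys the recursion of [E], and this recursion
    determines the value at [i] from those at larger indices. *)
Lemma suffix_unique (E : nat -> nat) :
  (forall i, i < k -> E i = 1 + \sum_(i.+1 <= j < k) (j - i) * (a j * E j)) ->
  forall i, i < k -> E i = V i.+1.
Proof.
move=> EE; suff : forall n i, i < k -> k - i <= n -> E i = V i.+1.
  by move=> h i ik; exact: (h k i ik (leq_subr _ _)).
elim=> [|n ihn] i ik; first by lia.
move=> kin; rewrite EE //.
have [_] : _ /\ V (k - (k - i.+1)) = _ := suffix_sums (leq_subr i.+1 k).
rewrite subKn // => ->; congr (_ + _); rewrite !big_nat.
apply: eq_bigr => j /andP[ij jk]; rewrite subSS ihn //; lia.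
Qed.

End SuffixSums.

(** * Expansion of [L_k] along increasing chains of indices *)

Section LpolySum.
Variables (k : nat) (a : 'I_k -> nat).

Let gap (s : seq nat) : nat :=
  \prod_(0 <= j < (size s).-1) (nth 0 s j.+1 - nth 0 s j).

(** Contribution of all continuations by [l] indices of a chain that has reached [i]; the step away
    from [i] counts among the gaps. *)
Let chain_sum l (i : nat) : nat :=
  \sum_(t : l.-tuple 'I_k | path ltn i (map val t))
    gap (i :: map val t) * \prod_(x <- t) a x.

Let gap_cons i s x : gap [:: i, x & s] = (x - i) * gap (x :: s).
Proof. by rewrite /gap /= big_nat_recl. Qed.

Let chain_sum0 i : chain_sum 0 i = 1.
Proof.
rewrite /chain_sum (eq_bigl xpredT) => [|t]; last by rewrite tuple0.
rewrite (eq_bigr (fun=> 1)) => [|t _]; first by rewrite sum1_card card_tuple.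
by rewrite tuple0 big_nil /gap /= big_geq.
Qed.

Let chain_sumS l i : chain_sum l.+1 i =
  \sum_(j : 'I_k | i < j) (j - i) * (a j * chain_sum l j).
Proof.
rewrite /chain_sum big_mkcond sum_tupleS [RHS]big_mkcond; apply: eq_bigr => j _ /=.
case: ltnP => /= ij; last by rewrite big1.
rewrite -big_mkcond !big_distrr; apply: eq_bigr => t _ /=.
by rewrite gap_cons big_cons; ring.
Qed.

(** Only [k - 1 - i] indices exceed [i], too few for a chain of length [l]. *)
Let chain_sum_eq0 l i : i < k -> k <= l + i -> chain_sum l i = 0.
Proof.
elim: l i => [|l ihl] i ik kli; first by lia.
rewrite chain_sumS big1 // => j ij; rewrite ihl ?muln0 //; lia.
Qed.

(** Chains are grouped by their smallest index [i], which contributes [a i] without a gap. *)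
Lemma Lpoly_chain_sum :
  Lpoly a = \sum_(i < k) a i * \sum_(0 <= l < k) chain_sum l i.
Proof.
rewrite /Lpoly big_add1 /=.
under [RHS]eq_bigr do rewrite big_distrr /=.
rewrite [RHS]exchange_big /=; apply: eq_bigr => l _.
rewrite big_mkcond sum_tupleS; apply: eq_bigr => i _.
rewrite /chain_sum big_distrr [RHS]big_mkcond /=; apply: eq_bigr => t _.
case: ifP => // _; rewrite big_cons /gap /= size_map size_tuple; ring.
Qed.

(** [Q] and [V] count the suffixes after a right edge and after any other letter. They satisfy the
    transfer recursion, and the chain sums [E] satisfy that of [suffix_unique], so both sides equal
    the sum of all [a i * V i.+1]. *)
Lemma Lpoly_word_sum (b : nat -> nat) : (forall i : 'I_k, b i = a i) ->
  Lpoly a = word_sum b k (Some true) 0.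
Proof.
move=> ba; pose V i := word_sum b (k - i) None i.
pose Q i := word_sum b (k - i) (Some true) i.
have Vk : V k = 1 by rewrite /V subnn word_sum0.
have Qk : Q k = 0 by rewrite /Q subnn word_sum0.
have QE i : i < k -> Q i = b i * V i.+1 + Q i.+1.
  move=> ik; rewrite /Q /V -(subnSK ik) word_sumS big_option_bool /=; ring.
have VE i : i < k -> V i = V i.+1 + Q i.
  move=> ik; rewrite QE // /Q /V -(subnSK ik) word_sumS big_option_bool /=.
  rewrite word_sum_Some_false; ring.
have [] := suffix_sums Vk Qk VE QE (leqnn k).
rewrite subnn /Q subn0 => -> _; rewrite Lpoly_chain_sum big_mkord.
apply: eq_bigr => i _; rewrite ba; congr (_ * _).
pose E i := \sum_(0 <= l < k) chain_sum l i.
apply: (suffix_unique (a := b) Vk Qk VE QE (E := E)) => // {}i ik; rewrite /E.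
have k0 : 0 < k by lia.
(* Splitting off the first index of a chain leaves one value of [l] fewer; the missing last term
   vanishes because the index [p] is positive. *)
have drop_last p : 0 < p -> p < k ->
    \sum_(0 <= l < k) chain_sum l p = \sum_(0 <= l < k.-1) chain_sum l p.
  by move=> p0 pk; rewrite -{1}(prednK k0) big_nat_recr //= chain_sum_eq0 //; lia.
rewrite -(prednK k0) big_nat_recl // chain_sum0 (prednK k0); congr (_ + _).
under eq_bigr do rewrite chain_sumS.
rewrite exchange_big /=.
transitivity (\sum_(j < k | i < j) (j - i) * (b j * \sum_(0 <= l < k) chain_sum l j)).
  apply: eq_bigr => j ij; have jk := ltn_ord j; rewrite ba.
  by rewrite drop_last ?(leq_ltn_trans _ ij) // !big_distrr.
rewrite (big_nat_widenl _ 0) // big_mkord.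
by apply: eq_bigl.
Qed.

End LpolySum.

(** * The graph and its matchings *)

(** The facets avoiding every [z i], encoded as functions from positions to letters so that each is
    counted once. *)
Definition free_facet (d : nat) (V : finType) (K : scomplex V)
    (pos : V -> 'I_d.+1) (z : 'I_d.+1 -> V) (w : {ffun 'I_d.+1 -> V}) : bool :=
  [forall i, (pos (w i) == i) && (w i != z i)] && face K (w @: finset.setT).

Section GraphA.
Variables (d : nat) (m : 'I_d.+1 -> nat).
Hypothesis m_gt0 : forall i, 0 < m i.

Local Notation G := (graph_a m).
Local Notation edge := (edge (graph_a m)).
Implicit Types (i j : 'I_d.+1) (x y : G) (e f : edge).

Let center_subproof i : i.*2 < d.*2.+1.
Proof. by have := ltn_ord i; lia. Qed.

Definition center i : G := inl (Ordinal (center_subproof i)).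

Lemma center_inj : injective center.
Proof. by move=> i j [] ij; apply/val_inj => /=; lia. Qed.

Lemma legs_center i : legs_a m (Ordinal (center_subproof i)) = m i.
Proof. by rewrite /legs_a /= odd_double doubleK valK. Qed.

Lemma legs_odd (p : 'I_(d.*2.+1)) : odd p -> legs_a m p = 0.
Proof. by rewrite /legs_a => ->. Qed.

Lemma even_center (p : 'I_(d.*2.+1)) : ~~ odd p -> exists i, inl p = center i.
Proof.
move=> p2; have pd : p./2 < d.+1 by have := ltn_ord p; lia.
exists (Ordinal pd); congr inl; apply/val_inj => /=; lia.
Qed.

Definition leaf i (l : 'I_(m i)) : G :=
  inr (Tagged (fun p => 'I_(legs_a m p)) (cast_ord (esym (legs_center i)) l)).

Lemma leaf_inj i : injective (@leaf i).
Proof.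
move=> l l'; pose dft := Tagged (fun p => 'I_(legs_a m p))
  (cast_ord (esym (legs_center i)) l).
move=> /(congr1 (fun x : G => if x is inr t then t else dft)).
by move=> /eqP; rewrite eq_Tagged => /eqP/cast_ord_inj.
Qed.

Lemma center_adj i y : adj (center i) y ->
  (exists l, y = @leaf i l) \/
  exists2 q : 'I_(d.*2.+1), y = inl q & q = i.*2.+1 :> nat \/ q.+1 = i.*2 :> nat.
Proof.
case: y => [q|[p l]] /=.
  by case/orP => /eqP h; right; exists q => //; [left|right].
move=> /eqP pE; subst p; left; exists (cast_ord (legs_center i) l).
by rewrite /leaf cast_ordK.
Qed.

Lemma center_not_adj i j : ~~ adj (center i) (center j).
Proof. by apply/negP => /=; lia. Qed.

(** The defaults here and in [opp] are never reached: every edge has exactly one end among the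
    vertices [center i]. *)
Definition pos e : 'I_d.+1 := odflt ord0 [pick i | center i \in val e].
Definition opp e : G := odflt (center ord0) [pick y in val e | y != center (pos e)].

(** Neighbours on the path have indices of opposite parity, and legs occur only at even indices. *)
Lemma edge_centerP e : exists i y,
  adj (center i) y /\ val e = [set center i; y]%SET.
Proof.
have /existsP[x /existsP[y /andP[xy /eqP eE]]] := valP e.
suff : (exists i, x = center i) \/ exists i, y = center i.
  case=> -[i E]; first by exists i, y; rewrite -E.
  by exists i, x; rewrite -E (adj_sym y x) finset.setUC.
move: xy; clear; case: x y => [p|[p l]] [q|[q l']] //=.
- move=> pq; have [p2|p2] := boolP (odd p).
    by right; apply: even_center; case/orP: pq p2 => /eqP <- /=; rewrite ?negbK.
  by left; exact: even_center.
- move=> /eqP qp; left; apply: even_center; apply/negP => p2.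
  by have := leq_ltn_trans (leq0n l') (ltn_ord l'); rewrite legs_odd // qp.
- move=> /eqP qp; right; apply: even_center; apply/negP => p2.
  by have := leq_ltn_trans (leq0n l) (ltn_ord l); rewrite legs_odd // qp.
Qed.

Lemma edge_eqP e i y : adj (center i) y -> val e = [set center i; y]%SET ->
  pos e = i /\ opp e = y.
Proof.
move=> iy eE.
have iE : pos e = i.
  rewrite /pos; case: pickP => [j|/(_ i)]; rewrite eE !inE ?eqxx //.
  move=> /orP[/eqP/center_inj//|/eqP jy].
  by move: (center_not_adj i j); rewrite jy iy.
split=> //; rewrite /opp iE; case: pickP => [y'|/(_ y)]; rewrite eE !inE ?eqxx ?orbT /=.
  by move=> /andP[/orP[/eqP->|/eqP->//]]; rewrite eqxx.
by move=> /negbT /negPn/eqP yi; move: (center_not_adj i i); rewrite -{2}yi iy.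
Qed.

Lemma edge_spec e :
  adj (center (pos e)) (opp e) /\ val e = [set center (pos e); opp e]%SET.
Proof.
have [i [y [iy eE]]] := edge_centerP e.
by have [-> ->] := edge_eqP iy eE.
Qed.

Lemma edge_inj e f : pos e = pos f -> opp e = opp f -> e = f.
Proof.
move=> pE oE; apply/val_inj.
by have [_ ->] := edge_spec e; have [_ ->] := edge_spec f; rewrite pE oE.
Qed.

Lemma exists_edge i y : adj (center i) y -> exists e, pos e = i /\ opp e = y.
Proof.
move=> iy; have iyP : is_edge [set center i; y]%SET.
  by apply/existsP; exists (center i); apply/existsP; exists y; rewrite iy eqxx.
by exists (exist _ [set center i; y]%SET iyP); exact: edge_eqP.
Qed.

Lemma leaf_adj i l : adj (center i) (@leaf i l).
Proof. by rewrite /= eqxx. Qed.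

Lemma exists_leaf_edge : exists le : forall i, 'I_(m i) -> edge,
  forall i l, pos (le i l) = i /\ opp (le i l) = leaf l.
Proof.
have le i l := boolp.cid (exists_edge (@leaf_adj i l)).
by exists (fun i l => projT1 (le i l)) => i l; exact: projT2 (le i l).
Qed.

(** Centres are pairwise non-adjacent, so the centre of one edge is never the opposite end of
    another. *)
Lemma disjoint_edges e f :
  [disjoint val e & val f] = (pos e != pos f) && (opp e != opp f).
Proof.
have [ea eE] := edge_spec e; have [fa fE] := edge_spec f.
rewrite eE fE finset.disjoints_subset finset.subUset !finset.sub1set !inE.
rewrite (inj_eq center_inj) !negb_or.
have -> : center (pos e) != opp f.
  by apply: contraNneq (center_not_adj (pos f) (pos e)) => ->.
have -> : opp e != center (pos f).
  by apply: contraNneq (center_not_adj (pos e) (pos f)) => <-.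
by rewrite andbT.
Qed.

Lemma matchingP (s : {set edge}) :
  reflect {in s &, forall e f, e != f -> pos e != pos f /\ opp e != opp f}
    (matching s).
Proof.
apply: (iffP forall_inP) => [h e f es fs ef|h e es].
  have /forall_inP/(_ f fs)/implyP/(_ ef) := h e es.
  by rewrite disjoint_edges => /andP.
apply/forall_inP => f fs; apply/implyP => ef.
by rewrite disjoint_edges; apply/andP; exact: h.
Qed.

Variable le : forall i, 'I_(m i) -> edge.
Hypothesis leP : forall i l, pos (@le i l) = i /\ opp (@le i l) = leaf l.

Definition base_leg i : edge := le (Ordinal (m_gt0 i)).

Lemma pos_base_leg : cancel base_leg pos.
Proof. by move=> i; have [] := leP (Ordinal (m_gt0 i)). Qed.

Lemma opp_leaf e i (l : 'I_(m i)) : opp e = leaf l -> pos e = i.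
Proof.
have [+ _] := edge_spec e => /[swap] -> /= /eqP[] h.
by apply/val_inj => /=; lia.
Qed.

Lemma matching_pos_inj s : matching s -> {in s &, injective pos}.
Proof.
move=> /matchingP sM e f es fs ef; apply/eqP/negPn/negP => /(sM _ _ es fs)[].
by rewrite ef eqxx.
Qed.

(** A leg in position [i] meets only edges in position [i], and for [i] in [S] the only such edge
    that [s] may contain is the base leg itself. *)
Lemma matching_cone s (S : {set 'I_d.+1}) : matching s ->
  (forall e, e \in s -> pos e \in S -> e = base_leg (pos e)) ->
  matching (s :|: base_leg @: S)%SET.
Proof.
move=> /matchingP sM sS.
have key e i : e \in (s :|: base_leg @: S)%SET -> i \in S -> pos e = i ->
    e = base_leg i.
  rewrite !inE => /orP[es iS ei|/imsetP[j _ ->] _]; first by have := sS e es; rewrite ei; apply.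
  by rewrite pos_base_leg => ->.
have key2 e i : e \in (s :|: base_leg @: S)%SET -> i \in S -> e != base_leg i ->
    pos e != i /\ opp e != opp (base_leg i).
  move=> eU iS ei; have pi : pos e != i by apply: contra_neq ei; exact: key.
  split=> //; apply: contra_neq pi; rewrite /base_leg.
  have [_ ->] := leP (Ordinal (m_gt0 i)); exact: opp_leaf.
apply/matchingP => e f eU fU.
have := fU; rewrite inE => /orP[fs|/imsetP[i iS ->] ef]; last first.
  by have := key2 e i eU iS ef; rewrite pos_base_leg.
have := eU; rewrite inE => /orP[es|/imsetP[i iS ->]]; first exact: sM.
rewrite eq_sym => /(key2 _ _ fU iS); rewrite pos_base_leg.
by rewrite eq_sym (eq_sym (opp f)).
Qed.

(** * Free facets as words, and their number *)

Definition code e : option bool :=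
  if opp e is inl q then Some ((pos e).*2 < q) else None.

Lemma code_None e : code e = None -> exists l, opp e = @leaf (pos e) l.
Proof.
rewrite /code; have [/center_adj[//|[q -> _]] _] := edge_spec e.
by [].
Qed.

Lemma code_Some e b : code e = Some b ->
  exists2 q : 'I_(d.*2.+1), opp e = inl q &
    if b then q = (pos e).*2.+1 :> nat else q.+1 = (pos e).*2.
Proof.
rewrite /code; have [/center_adj[[l ->]//|[q -> qE]] _] := edge_spec e.
by move=> [<-]; exists q => //; case: ltnP; lia.
Qed.


Lemma free_facetE (w : {ffun 'I_d.+1 -> edge}) :
  free_facet (matching_complex G) pos base_leg w =
  [forall i, (pos (w i) == i) && (w i != base_leg i)] &&
  good_word (Some true) [tuple code (w i) | i < d.+1].
Proof.
rewrite /free_facet; case: forallP => //= wP.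
have wpos i : pos (w i) = i by have /andP[/eqP] := wP i.
have nthE i : nth None [tuple code (w i) | i < d.+1] i = code (w i).
  by rewrite -tnth_nth tnth_mktuple.
have sz : size [tuple code (w i) | i < d.+1] = d.+1 by rewrite size_tuple.
have last_code : last (Some true) [tuple code (w i) | i < d.+1] = code (w ord_max).
  by rewrite (last_nth None) sz /= -nthE.
apply/matchingP/andP => [wM|[/(pathP None)]].
  split; last first.
    rewrite last_code; apply/eqP => /code_Some[q _ qE].
    by have := ltn_ord q; rewrite wpos /= in qE; lia.
  apply/(pathP None) => i; rewrite sz => id.
  rewrite /follows; apply/negP => /andP[].
  rewrite -[i]/(val (Ordinal id)) nthE => + /eqP/code_Some[q' q'E q'i].
  (* A left edge in position 0 would end before the first path vertex, in accordance with the letter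
     [Some true] placed in front. *)
  case: i id q'E q'i => [|i] id q'E q'i /=; first by rewrite wpos /= in q'i; lia.
  have id' : i < d.+1 by lia.
  rewrite -[i]/(val (Ordinal id')) nthE => /eqP/code_Some[q qE qi].
  rewrite !wpos /= in qi q'i.
  have [|||_] := wM (w (Ordinal id')) (w (Ordinal id)).
  - by apply/imsetP; exists (Ordinal id').
  - by apply/imsetP; exists (Ordinal id).
  - by apply: contraTneq isT => /(congr1 pos); rewrite !wpos => -[]; lia.
  rewrite qE q'E => /eqP; case; congr inl; apply/val_inj => /=; lia.
rewrite sz => wg _ e f /imsetP[i _ ->] /imsetP[j _ ->] ij.
have {}ij : i != j by apply: contra_neq ij => ->.
rewrite !wpos; split=> //; apply/eqP => oij.
(* A common opposite end is not a leaf, since a leaf has a single centre. A common path vertex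
   forces consecutive positions, with a right edge followed by a left edge. *)
have main i' j' : opp (w i') = opp (w j') -> i' < j' -> False.
  move=> o ij'; have := wg j' (ltn_ord j'); rewrite nthE.
  have := center_adj (proj1 (edge_spec (w i'))); rewrite o wpos => -[[l ol]|[q qE qi]].
    have := opp_leaf ol; rewrite wpos => jE; move: ij'; rewrite jE ltnn //.
  have := center_adj (proj1 (edge_spec (w j'))); rewrite wpos qE => -[[l]//|[q' [<-] q'j]].
  case: j' => [[|j'] jd] /= in o ij' qE q'j *; first by lia.
  have id' : j' < d.+1 by lia.
  rewrite (nthE (Ordinal id')) (_ : w (Ordinal id') = w i'); last first.
    by congr (w _); apply/val_inj => /=; lia.
  rewrite /follows /code o qE !wpos /= => /negP; apply.
  by apply/andP; split; apply/eqP; congr Some; lia.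
have [lt|gt|/val_inj eq] := ltngtP i j.
- exact: main oij lt.
- exact: main (esym oij) gt.
- by rewrite eq eqxx in ij.
Qed.

Let letters i (c : option bool) :=
  [pred e | [&& pos e == i, e != base_leg i & code e == c]].

Let card_letters_None i : #|letters i None| = m i - 1.
Proof.
pose L : {set edge} := [set le l | l : 'I_(m i)]%SET.
transitivity #|L :\ base_leg i|.
  apply: eq_card => e; rewrite !inE; case: (eqVneq e (base_leg i)) => [->|ne] /=.
    by rewrite andbF.
  apply/andP/imsetP => [[/eqP ei /eqP/code_None[l el]]|[l _ ->]].
    rewrite ei in l el; exists l => //; have [p o] := leP l.
    by apply: edge_inj; rewrite ?p ?o.
  by have [p o] := leP l; rewrite p eqxx /code o.
have -> : #|L :\ base_leg i| = #|L| - 1.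
  have := cardsD1 (base_leg i) L.
  rewrite (_ : base_leg i \in _) ?add1n => [->|]; first by rewrite subn1.
  by apply/imsetP; exists (Ordinal (m_gt0 i)).
rewrite card_imset ?card_ord // => l l' /(congr1 opp).
by have [_ ->] := leP l; have [_ ->] := leP l'; exact: leaf_inj.
Qed.

Let card_letters_Some i b : (if b then i < d else 0 < i) -> #|letters i (Some b)| = 1.
Proof.
move=> ib; pose q := if b then i.*2.+1 else i.*2.-1.
have qd : q < d.*2.+1 by rewrite /q; have := ltn_ord i; move: (ib); case: (b) => /=; lia.
have [|e [ei eo]] := @exists_edge i (inl (Ordinal qd)).
  by rewrite /= /q; move: (ib); case: (b) => /=; lia.
apply: (fintype.eq_card1 (x := e)) => f; rewrite !inE.
apply/and3P/eqP => [[/eqP fi _ /eqP/code_Some[q' fo qf]]|->].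
  apply: edge_inj; first by rewrite ei.
  rewrite fo eo; congr inl; apply/val_inj => /=; rewrite /q; move: qf; rewrite fi.
  by case: (b) => ?; lia.
have ce : code e = Some b.
  by rewrite /code eo ei /= /q; congr Some; move: (ib); case: (b) => /=; lia.
rewrite ei ce !eqxx; split=> //; apply: contra_eq_neq ce => ->.
by rewrite /code; have [_ ->] := leP (Ordinal (m_gt0 i)).
Qed.

(** Facets are sorted by their codes. For a good code the letters are chosen independently: one of
    the [m i - 1] legs other than the base leg, or the single path edge, which exists because the
    code is good. *)
Lemma card_free_facet :
  #|[pred w | free_facet (matching_complex G) pos base_leg w]| =
  word_sum (fun p : nat => m (inord p) - 1) d.+1 (Some true) 0.
Proof.
pose codes (w : {ffun 'I_d.+1 -> edge}) := [tuple code (w i) | i < d.+1].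
rewrite -sum1_card (partition_big codes xpredT) //= /word_sum; apply: eq_bigr => t _.
have [tg|/negPf tg] := boolP (good_word (Some true) t); last first.
  rewrite big_pred0 // => w; rewrite inE free_facetE -/(codes w).
  by have [->|] := eqVneq (codes w) t; rewrite ?andbF // tg andbF.
rewrite mul1n.
transitivity #|family (fun i => letters i (tnth t i))|.
  rewrite -sum1_card; apply: eq_bigl => w; rewrite inE free_facetE -/(codes w).
  apply/andP/familyP => [[/andP[/forallP wP _] /eqP <-] i|wF].
    by rewrite inE /codes tnth_mktuple eqxx andbT.
  have ct : codes w = t.
    by apply: eq_from_tnth => i; rewrite tnth_mktuple; have /and3P[_ _ /eqP] := wF i.
  rewrite ct eqxx tg andbT; split=> //; apply/forallP => i.
  by have /and3P[-> ->] := wF i.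
rewrite card_family foldrE big_map big_enum /=; apply: eq_bigr => i _.
rewrite add0n /letter_weight -tnth_nth inord_val.
have ti : tnth t i = nth None t i by rewrite (tnth_nth None).
case tE : (tnth t i) => [b|]; last exact: card_letters_None.
apply: card_letters_Some; case/andP: tg => /(pathP None) tp tl.
case: b tE; rewrite ti => tE.
  rewrite ltn_neqAle -ltnS ltn_ord andbT; apply: contra tl => /eqP id.
  have eid : nth None t i = nth None t d by congr nth.
  by rewrite (last_nth None) size_tuple /= -eid tE.
rewrite lt0n; apply/eqP => i0; have := tp 0; rewrite size_tuple => /(_ isT).
by move: tE; rewrite i0 /= => ->.
Qed.

End GraphA.

(** * Topological preliminaries *)

Import Order.TTheory GRing.Theory Num.Theory.
Import numFieldNormedType.Exports.

Local Open Scope classical_set_scope.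
Local Open Scope ring_scope.

Lemma compact_set_type (X : topologicalType) (A : set X) :
  compact A -> compact [set: A].
Proof.
move=> /compact_near_coveringP cA; apply/compact_near_coveringP.
move=> J F P FF nP.
(* [P] lives on the subtype; quantifying over membership proofs extends it to [X], vacuously off
   [A]. *)
pose Q (i : J) x := forall h : x \in A, P i (exist _ x h).
suff /(cA J F Q FF) : forall x, A x -> \forall x' \near x & i \near F, Q i x'.
  by apply: filterS => i Qi [x h] _; apply: Qi; exact: set_mem.
move=> x Ax.
have [[U V] /= [nU FV] UV] := nP (exist _ x (mem_set Ax)) I.
move: nU; rewrite nbhsE /= => -[B [[G oG <-] Gx] GU].
exists (G, V) => //=.
  by split=> //; apply: open_nbhs_nbhs; split.
move=> [y i] /= [Gy Vi] h; apply: (UV (exist _ y h, i)); split => //; exact: GU.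
Qed.

Lemma hausdorff_set_type (X : topologicalType) (A : set X) :
  hausdorff_space X -> hausdorff_space A.
Proof.
move=> hX x y cxy; apply/val_inj/hX => U V nU nV.
have /(_ _ _)[||z [Uz Vz]] := cxy (val @^-1` U) (val @^-1` V).
- exact: (@initial_continuous A X set_val).
- exact: (@initial_continuous A X set_val).
by exists (val z).
Qed.

Lemma continuous_set_type (X Y : topologicalType) (A : set Y) (f : X -> A) :
  continuous (fun x => val (f x)) -> continuous f.
Proof.
move=> cf x U; rewrite {1}nbhsE /= => -[_ [[G oG <-] Gx] GU].
apply: filterS GU _; apply: (cf x); exact: open_nbhs_nbhs.
Qed.

Lemma continuous_ptws (X : topologicalType) (R : realType) (V : finType)
    (f : X -> {ptws V -> R}) :
  (forall v, continuous (fun x => f x v)) -> continuous f.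
Proof.
move=> cf x; apply/cvg_sup => v U [_ [[G oG <-] Gx] GU].
by apply: (filterS GU); apply: (cf v x); exact: open_nbhs_nbhs.
Qed.

Lemma continuous_mx (X T : topologicalType) m n (f : X -> 'M[T]_(m, n)) :
  (forall i j, continuous (fun x => f x i j)) -> continuous f.
Proof.
move=> cf x U [P nP PU]; apply: filterS PU _.
have : \forall y \near x, forall i, forall j, P i j (f y i j).
  apply: filter_forall => i; apply: filter_forall => j.
  exact: (cf i j x).
by [].
Qed.

(* A continuous map from a compact space onto a Hausdorff space is proper, so
   its product with any space is again a quotient map. *)
Lemma continuous_factor (X W T Y : topologicalType) (f : X -> W) (s : W -> X)
    (F : X * T -> Y) :
  compact [set: X] -> hausdorff_space W -> continuous f -> cancel s f ->
  continuous F -> (forall x t, F (s (f x), t) = F (x, t)) ->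
  continuous (fun p => F (s p.1, p.2)).
Proof.
move=> /compact_near_coveringP cX hW cf sK cF FE [w t] U nU.
(* By compactness it suffices to argue near each [x]: on the fibre over [w] continuity of [F]
   applies, and off it Hausdorff separation falsifies the premise of [P]. *)
pose P (p : W * T) x := f x = p.1 -> U (F (x, p.2)).
suff /(cX _ (nbhs (w, t)) P _) : forall x, [set: X] x ->
    \forall x' \near x & p \near nbhs (w, t), P p x'.
  by apply: filterS => -[w' t'] /(_ (s w') I (sK _)).
move=> x _; rewrite /P.
have [fxw|/eqP fxw] := pselect (f x = w).
  have nUx : nbhs (F (x, t)) U by rewrite -FE fxw.
  have [[A B] /= [nA nB] AB] := cF _ _ nUx.
  exists (A, (setT `*` B)) => /=.
    by split=> //; exists (setT, B) => //=; split=> //; exact: filterT.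
  by move=> [x' [w' t']] /= [Ax' [_ Bt']] _; exact: (AB (x', t')).
have := hW; rewrite open_hausdorff => /(_ _ _ fxw)[[A B] /= [Ax Bw] [oA oB AB]].
exists (f @^-1` A, (B `*` setT)) => /=.
  split; first by apply: cf; apply: open_nbhs_nbhs; split=> //; exact: set_mem.
  exists (B, setT) => //=; split; last exact: filterT.
  by apply: open_nbhs_nbhs; split=> //; exact: set_mem.
move=> [x' [w' t']] /= [Ax' [Bw' _]] fx'.
have : (A `&` B) w' by split=> //; rewrite -fx'.
by rewrite (eqP AB).
Qed.

(** [s] is a mere set-theoretic section. As [f] composed with [H] is constant on the fibres of [f],
    it descends to a homotopy of [W]; as [H] at time 1 is constant on them too, it descends to the
    inverse map. *)
Lemma homotopy_equivalent_collapse (R : realType) (X W : topologicalType)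
    (f : X -> W) (s : W -> X) (H : X * R -> X) :
  compact [set: X] -> hausdorff_space W ->
  continuous f -> cancel s f -> continuous H ->
  (forall x, H (x, 0) = x) ->
  (forall x t, f (H (s (f x), t)) = f (H (x, t))) ->
  (forall x, H (s (f x), 1) = H (x, 1)) ->
  homotopy_equivalent R X W.
Proof.
move=> cX hW cf sK cH H0 fH H1.
have cpair (Z : topologicalType) (g : R -> R) : continuous g ->
    continuous (fun p : Z * R => (p.1, g p.2)).
  move=> cg p; apply: (@cvg_pair _ _ _ _ (nbhs p.1) (nbhs (g p.2))).
    by case: p => a b; exact: cvg_fst.
  by apply: (@continuous_comp _ _ _ snd g); [case: p => a b; exact: cvg_snd|exact: cg].
have c1 : continuous (cst (1 : R) : R -> R) by exact: cst_continuous.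
have crev : continuous (fun t : R => 1 - t).
  by move=> t; apply: continuousB; [exact: cst_continuous|exact: cvg_id].
exists f, (fun w => H (s w, 1)); split => //.
(* The descent along [f] is used with a dummy time parameter, which is then set to 0. *)
- have cH1 : continuous (fun x : X * R => H (x.1, 1)).
    by move=> p; apply: (continuous_comp (@cpair X _ c1 p) (cH _)).
  have := continuous_factor cX hW cf sK cH1 (fun x _ => H1 x).
  move=> cg w; have c0 : {for w, continuous (fun w : W => (w, 0 : R))}.
    by apply: (@cvg_pair _ _ _ _ (nbhs w) (nbhs (0 : R))); [exact: cvg_id|exact: cvg_cst].
  exact: (continuous_comp c0 (cg (w, 0))).
- exists (fun p => H (p.1, 1 - p.2)); split=> [|x|x] /=.
  + apply: continuous_subspaceT => p; exact: (continuous_comp (@cpair X _ crev p) (cH _)).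
  + by rewrite subr0 H1.
  + by rewrite subrr H0.
- exists (fun p => f (H (s p.1, 1 - p.2))); split=> [|x|x] /=.
  + have cfH : continuous (fun p => f (H p)).
      by move=> p; apply: continuous_comp; [exact: cH|exact: cf].
    have cG := continuous_factor cX hW cf sK cfH fH.
    apply: continuous_subspaceT => p.
    exact: (continuous_comp (@cpair W _ crev p) (cG _)).
  + by rewrite subr0.
  + by rewrite subrr H0 sK.
Qed.

(** * The realization *)

Section RealValued.
Variables (R : realType) (X : topologicalType).
Implicit Types f g : X -> R.

Lemma continuous_addr f g :
  continuous f -> continuous g -> continuous (fun x => f x + g x).
Proof. by move=> cf cg x; apply: continuousD; [exact: cf|exact: cg]. Qed.

Lemma continuous_subr f g :
  continuous f -> continuous g -> continuous (fun x => f x - g x).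
Proof. by move=> cf cg x; apply: continuousB; [exact: cf|exact: cg]. Qed.

Lemma continuous_mulr f g :
  continuous f -> continuous g -> continuous (fun x => f x * g x).
Proof. by move=> cf cg x; apply: continuousM; [exact: cf|exact: cg]. Qed.

Lemma continuous_divr f g : (forall x, g x != 0) ->
  continuous f -> continuous g -> continuous (fun x => f x / g x).
Proof.
move=> g0 cf cg; apply: (continuous_mulr (g := fun x => (g x)^-1)) => // x.
by apply: continuousV; [exact: g0|exact: cg].
Qed.

Lemma continuous_maxr f g :
  continuous f -> continuous g -> continuous (fun x => Num.max (f x) (g x)).
Proof. by move=> cf cg x; apply: continuous_max; [exact: cf|exact: cg]. Qed.

Lemma continuous_minr f g :
  continuous f -> continuous g -> continuous (fun x => Num.min (f x) (g x)).
Proof. by move=> cf cg x; apply: continuous_min; [exact: cf|exact: cg]. Qed.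

Lemma continuous_sumr (I : finType) (P : pred I) (F : I -> X -> R) :
  (forall i, continuous (F i)) -> continuous (fun x => \sum_(i | P i) F i x).
Proof.
move=> cF; apply: continuous_big => //.
by move=> p; apply: continuousD; [exact: cvg_fst|exact: cvg_snd].
Qed.

Lemma continuous_prodr (I : finType) (P : pred I) (F : I -> X -> R) :
  (forall i, continuous (F i)) -> continuous (fun x => \prod_(i | P i) F i x).
Proof.
move=> cF; apply: continuous_big => //.
by move=> p; apply: continuousM; [exact: cvg_fst|exact: cvg_snd].
Qed.

Lemma continuous_bigminr (I : finType) f (F : I -> X -> R) :
  continuous f -> (forall i, continuous (F i)) ->
  continuous (fun x => \big[Num.min/f x]_i F i x).
Proof.
move=> cf cF; suff : forall r : seq I,
    continuous (fun x => \big[Num.min/f x]_(i <- r) F i x) by exact.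
elim=> [|i r ihr].
  rewrite (_ : (fun _ => _) = f) //.
  by apply/funext => x; rewrite big_nil.
rewrite (_ : (fun _ => _) =
  fun x => Num.min (F i x) (\big[Num.min/f x]_(j <- r) F j x)).
  exact: continuous_minr.
by apply/funext => x; rewrite big_cons.
Qed.

End RealValued.

Section Realization.
Variables (R : realType) (V : finType) (K : scomplex V).
Implicit Types x y : realization R K.

Lemma coord_ge0 x v : 0 <= val x v.
Proof. by case: x => x /= /set_mem[]. Qed.

Lemma sum_coord x : \sum_v val x v = 1.
Proof. by case: x => x /= /set_mem[]. Qed.

Lemma face_supp x : face K [set v | val x v != 0]%SET.
Proof. by case: x => x /= /set_mem[]. Qed.

Lemma eq_coord x y : (forall v, val x v = val y v) -> x = y.
Proof. by move=> xy; apply/val_inj/funext. Qed.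

Lemma continuous_proj v : continuous (fun x : {ptws V -> R} => x v).
Proof. by move=> x; exact: (@proj_continuous V (fun=> R) v x). Qed.

Lemma continuous_coord v : continuous (fun x : realization R K => val x v).
Proof.
have cval : continuous (val : realization R K -> {ptws V -> R}).
  exact: initial_continuous.
by move=> x; exact: (continuous_comp (cval x) (@continuous_proj v _)).
Qed.

(** The realization is closed in a cube: the support is a face exactly when, for every non-face, the
    product of its coordinates vanishes. *)
Lemma compact_realization : compact [set: realization R K].
Proof.
apply: compact_set_type.
have cB : compact [set x : {ptws V -> R} | forall v, `[0, 1]%classic (x v)].
  by apply: (@tychonoff V (fun=> R) (fun=> `[0, 1]%classic)) => v; exact: segment_compact.
apply: (subclosed_compact _ cB).
- rewrite (_ : realization_set _ =
      (\bigcap_v [set x : {ptws V -> R} | 0 <= x v]) `&`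
      [set x | \sum_v x v = 1] `&`
      \bigcap_(s in [set s : {set V} | ~~ face K s])
        [set x | \prod_(v in s) x v = 0]).
  + apply: closedI; first apply: closedI.
    * apply: closed_bigI => v _.
      apply: (@preimage_closed _ _ (fun x : {ptws V -> R} => x v) [set a | 0 <= a]).
        by move=> x _; exact: continuous_proj.
      exact: closed_ge.
    * apply: (@preimage_closed _ _ (fun x : {ptws V -> R} => \sum_v x v)
               [set a | a = 1]); last exact: closed_eq.
      by move=> x _; apply: (@continuous_sumr R _ V xpredT) continuous_proj x.
    * apply: closed_bigI => s _.
      apply: (@preimage_closed _ _ (fun x : {ptws V -> R} => \prod_(v in s) x v)
               [set a | a = 0]); last exact: closed_eq.
      by move=> x _; apply: (@continuous_prodr R _ V (mem s)) continuous_proj x.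
  + apply/seteqP; split=> x /=.
      move=> [x0 x1 xK]; split=> [|s /= sK]; first by split=> // v _; exact: x0.
      apply/eqP.
      apply: contraNT sK => /prodf_neq0 xs.
      by apply: face_sub xK; apply/fintype.subsetP => v vs; rewrite inE xs.
    move=> [[x0 x1] xK]; split=> // [v|]; first exact: x0.
    apply: contraT => /xK /= /eqP/prodf_eq0[v].
    by rewrite inE => /negP.
- move=> x /= [x0 x1 _] v; rewrite in_itv /= x0 /= -x1 (bigD1 v) //= lerDl.
  by rewrite sumr_ge0.
Qed.

Lemma realization_normalize (X : topologicalType) (u : X -> V -> R) :
  (forall p v, 0 <= u p v) -> (forall p, \sum_v u p v != 0) ->
  (forall p, face K [set v | u p v != 0]%SET) ->
  (forall v, continuous (fun p => u p v)) ->
  {g : X -> realization R K | continuous g &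
    forall p v, val (g p) v = u p v / \sum_w u p w}.
Proof.
move=> u0 su uK cu; pose g0 p : {ptws V -> R} := fun v => u p v / \sum_w u p w.
have gK p : g0 p \in realization_set (R := R) K.
  apply/mem_set; split=> [v||].
  - by rewrite divr_ge0 // sumr_ge0.
  - by rewrite -mulr_suml divff.
  - apply: face_sub (uK p); apply/fintype.subsetP => v; rewrite !inE.
    by apply: contra => /eqP uv; rewrite /g0 uv mul0r.
exists (fun p => exist _ (g0 p) (gK p)) => //.
apply: continuous_set_type; apply: continuous_ptws => v /=.
apply: continuous_divr => //; exact: continuous_sumr.
Qed.

End Realization.

(** * The deformation *)

Section Collapse.
Variables (R : realType) (d : nat) (V : finType) (K : scomplex V).
Variables (pos : V -> 'I_d.+1) (z : 'I_d.+1 -> V).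
Hypothesis pos_z : cancel z pos.
Hypothesis pos_inj : forall s, face K s -> {in s &, injective pos}.
Hypothesis face_cone : forall s (S : {set 'I_d.+1}), face K s ->
  (forall v, v \in s -> pos v \in S -> v = z (pos v)) -> face K (s :|: z @: S)%SET.

Local Notation X := (realization R K).
Implicit Types (x y : X) (p : X * R) (t : R).

(** The points where some [mass i] vanishes form the subcomplex to be contracted. *)
Definition mass (i : 'I_d.+1) (x : X) : R :=
  \sum_(v | (pos v == i) && (v != z i)) val x v.

(** Half of [1 / (d + 1)]: as a face has at most [d + 1] vertices, some coordinate remains positive
    when all are lowered by [eps]. *)
Let eps : R := (d.+1.*2)%:R^-1.

Let eps_gt0 : 0 < eps.
Proof. by rewrite invr_gt0 ltr0n. Qed.

Lemma coord_le_mass x v : v != z (pos v) -> val x v <= mass (pos v) x.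
Proof.
move=> vz; rewrite /mass (bigD1 v) /=; last by rewrite eqxx.
by rewrite lerDl sumr_ge0 // => w _; exact: coord_ge0.
Qed.

Lemma mass_eq0 i x :
  (mass i x = 0) <-> (forall v, pos v = i -> v != z i -> val x v = 0).
Proof.
split=> [xi v vi vz|x0].
  by apply/eqP; rewrite eq_le coord_ge0 andbT -xi -vi coord_le_mass ?vi.
by rewrite /mass big1 // => v /andP[/eqP]; exact: x0.
Qed.

Lemma card_face s : face K s -> (#|s| <= d.+1)%N.
Proof.
move=> /pos_inj sinj; rewrite -(card_in_imset sinj) -[leqRHS]card_ord.
exact: max_card.
Qed.

Let exists_large x : exists v, eps < val x v.
Proof.
apply: contrapT => /forallNP xle; have : (1 : R) <= 2^-1; last by lra.
rewrite -[leLHS](sum_coord x) (bigID (mem [set v | val x v != 0]%SET)) /=.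
rewrite [X in _ + X]big1 ?addr0; last by move=> v; rewrite inE negbK => /eqP.
apply: (@le_trans _ _ (\sum_(v in [set v | val x v != 0]%SET) eps)).
  by apply: ler_sum => v _; rewrite leNgt; apply/negP/xle.
rewrite sumr_const -[leLHS]mulr_natl /eps ler_pdivrMr ?ltr0n //.
rewrite -muln2 natrM mulrC mulfK ?pnatr_eq0 // ler_nat.
exact/card_face/face_supp.
Qed.

Let clamp t : R := Num.min 1 (Num.max 0 t).

Let clamp_ge0 t : 0 <= clamp t.
Proof. by rewrite /clamp le_min ler01 le_max lexx. Qed.

Let clamp_le1 t : clamp t <= 1.
Proof. by rewrite /clamp ge_min lexx. Qed.

Let clamp_le0E t : t <= 0 -> clamp t = 0.
Proof. by move=> t0; rewrite /clamp max_l // min_r. Qed.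

Let clamp_ge1E t : 1 <= t -> clamp t = 1.
Proof. by move=> t1; rewrite /clamp max_r ?min_l //; lra. Qed.

(** The clocks of consecutive stages differ by 1, so a stage that has begun finds the previous one
    complete. *)
Let clampB t : 0 < clamp (t - 1) -> clamp t = 1.
Proof.
move=> h; apply: clamp_ge1E; rewrite leNgt; apply/negP => t1.
by move: h; rewrite clamp_le0E ?ltxx //; lra.
Qed.

(** A bump function: 1 where [mass i] vanishes, positive exactly where it is below [eps]. *)
Let phi i x : R := Num.max 0 (1 - mass i x / eps).
Let lam x : R := \sum_i phi i x.

Let phi_ge0 i x : 0 <= phi i x. Proof. by rewrite le_max lexx. Qed.

Let lam_ge0 x : 0 <= lam x. Proof. by rewrite sumr_ge0. Qed.

Let lam_ge1 i x : mass i x = 0 -> 1 <= lam x.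
Proof.
move=> xi; rewrite /lam (bigD1 i) //= {1}/phi xi mul0r subr0 max_r ?ler01 //.
by rewrite lerDl sumr_ge0.
Qed.

Let phi_gt0 i x : 0 < phi i x -> mass i x < eps.
Proof. by rewrite /phi lt_max ltxx /= subr_gt0 ltr_pdivrMr // mul1r. Qed.

(* The unnormalised weights of the homotopy: for [t <= 1/3] every coordinate is
   lowered by [eps], cut off at 0; for [1/3 <= t <= 2/3] mass is transferred to
   the [z i] for which the mass off [z i] in position [i] is less than [eps]; for
   [t >= 2/3] the mass carried by the simplex of the [z i] moves to [z 0]. *)
Let stage1 p := clamp (3 * p.2).
Let stage2 p := clamp (3 * p.2 - 1).
Let stage3 p := clamp (3 * p.2 - 1 - 1).
Let excess p := Num.max 0 (2 * lam p.1 - 1).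
Let cA p := Num.max 0 (1 - 2 * (stage2 p * lam p.1)).
Let cB p := stage2 p * (1 - stage3 p * Num.min 1 (excess p)).
Let cC p := stage3 p * excess p.
Let shrink p v := Num.max 0 (val p.1 v - stage1 p * eps).
Let push p v := cA p * shrink p v +
  (v == z (pos v))%:R * (cB p * phi (pos v) p.1) + (v == z ord0)%:R * cC p.

Let stage_ge0 p : [/\ 0 <= stage1 p, 0 <= stage2 p & 0 <= stage3 p].
Proof. by split; exact: clamp_ge0. Qed.
Let stage_le1 p : [/\ stage1 p <= 1, stage2 p <= 1 & stage3 p <= 1].
Proof. by split; exact: clamp_le1. Qed.
Let excess_ge0 p : 0 <= excess p. Proof. by rewrite le_max lexx. Qed.
Let cA_ge0 p : 0 <= cA p. Proof. by rewrite le_max lexx. Qed.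
Let cC_ge0 p : 0 <= cC p.
Proof. by have [_ _ c0] := stage_ge0 p; rewrite mulr_ge0. Qed.
Let shrink_ge0 p v : 0 <= shrink p v. Proof. by rewrite le_max lexx. Qed.

Let cB_ge0 p : 0 <= cB p.
Proof.
have [_ b0 c0] := stage_ge0 p; have [_ b1 c1] := stage_le1 p.
by rewrite mulr_ge0 // subr_ge0 mulr_ile1 ?ge_min ?lexx // le_min ler01 excess_ge0.
Qed.

Let push_ge0 p v : 0 <= push p v.
Proof.
apply: addr_ge0; first apply: addr_ge0; apply: mulr_ge0 => //.
by apply: mulr_ge0.
Qed.

(** A coordinate above [eps] survives the shrinking, so all weights can vanish only where [cA] does.
    There [stage2 p * lam p.1] is at least 1/2, so some [z i] has received weight, and whatever
    stage 3 takes from it reappears at [z ord0]. *)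
Let sum_push p : \sum_v push p v != 0.
Proof.
rewrite gt_eqF // lt0r sumr_ge0 // andbT.
apply/eqP => /psumr_eq0P-/(_ (fun v _ => push_ge0 p v)) push0.
have pz (v : V) : [/\ cA p * shrink p v = 0,
    (v == z (pos v))%:R * (cB p * phi (pos v) p.1) = 0
    & (v == z ord0)%:R * cC p = 0].
  have := push0 v isT; rewrite /push => h.
  have h1 : 0 <= cA p * shrink p v by rewrite mulr_ge0.
  have h2 : 0 <= (v == z (pos v))%:R * (cB p * phi (pos v) p.1).
    by apply: mulr_ge0 => //; apply: mulr_ge0.
  have h3 : 0 <= (v == z ord0)%:R * cC p by rewrite mulr_ge0 ?ler0n.
  by split; lra.
have [v vlarge] := exists_large p.1.
have A0 : cA p = 0.
  have [/eqP + _ _] := pz v; rewrite mulf_eq0 => /orP[/eqP//|].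
  rewrite gt_eqF // /shrink lt_max subr_gt0 (le_lt_trans _ vlarge) ?orbT //.
  by have [a1 _ _] := stage_le1 p; rewrite ler_piMl // ltW.
have bl : 1 <= 2 * (stage2 p * lam p.1).
  by rewrite -subr_le0 -A0 le_max lexx orbT.
have b0 : 0 < stage2 p.
  by rewrite lt0r [_ <= _]clamp_ge0 andbT; apply/eqP => b0; move: bl; rewrite b0; lra.
have l0 : 0 < lam p.1.
  by rewrite lt0r lam_ge0 andbT; apply/eqP => b1; move: bl; rewrite b1; lra.
have C0 : cC p = 0 by have [_ _] := pz (z ord0); rewrite eqxx mul1r.
have B0 : cB p = stage2 p.
  rewrite /cB; have [->|/eqP] := eqVneq (stage3 p) 0; first lra.
  move: C0; rewrite /cC => /eqP; rewrite mulf_eq0 => /orP[/eqP//|/eqP ->] _.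
  by rewrite min_r ?ler01 //; lra.
have : lam p.1 = 0; last by move/eqP; rewrite gt_eqF.
rewrite /lam big1 // => i _; have [_ + _] := pz (z i).
rewrite pos_z eqxx mul1r B0 => /eqP; rewrite mulf_eq0 gt_eqF //=.
by move/eqP.
Qed.

Let face_push p : face K [set v | push p v != 0]%SET.
Proof.
have face0 : face K finset.set0.
  by apply: face_sub (face_vertex K (z ord0)); exact: finset.sub0set.
(* Stage 3 acts only where [lam] exceeds 1/2. There the completed stage 2 has made [cA] zero, and
   the support lies in the simplex of the [z i]. *)
have [c0|c0] := eqVneq (cC p) 0; last first.
  have ex0 : excess p != 0 by apply: contraNneq c0; rewrite /cC => ->; rewrite mulr0.
  have s0 : 0 < stage3 p.
    by rewrite lt0r [_ <= _]clamp_ge0 andbT; apply: contraNneq c0; rewrite /cC => ->; rewrite mul0r.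
  have b1 : stage2 p = 1 by exact: clampB.
  have A0 : cA p = 0.
    have : 0 < excess p by rewrite lt0r ex0 excess_ge0.
    by rewrite /excess lt_max ltxx /= /cA b1 => ex1; apply/max_l; lra.
  have : face K (finset.set0 :|: z @: finset.setT)%SET.
    by apply: face_cone => // v; rewrite inE.
  rewrite finset.set0U; apply: face_sub.
  apply/fintype.subsetP => v; rewrite inE /push A0 mul0r add0r => h.
  apply/imsetP; have [->|vz] := eqVneq v (z ord0); first by exists ord0.
  exists (pos v) => //; apply/eqP; apply: contraNT h => /negPf ->.
  by rewrite (negPf vz) !mul0r addr0.
have [b0|b0] := eqVneq (stage2 p) 0.
  apply: face_sub (face_supp p.1); apply/fintype.subsetP => v; rewrite !inE /push c0.
  rewrite /cB b0 !mul0r mulr0 addr0 mulr0 addr0; apply: contra => /eqP v0.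
  by rewrite /shrink v0 sub0r max_l ?mulr0 // oppr_le0 mulr_ge0 ?[_ <= stage1 _]clamp_ge0 // ltW.
have a1 : stage1 p = 1 by apply: clampB; rewrite lt0r b0 [_ <= _]clamp_ge0.
(* After stage 1 the support consists of coordinates above [eps] and of some [z i] with [phi i]
   positive. For such [i] every letter off [z i] is below [eps], so [face_cone] applies. *)
pose s := [set v | eps < val p.1 v]%SET; pose S := [set i | 0 < phi i p.1]%SET.
have sK : face K s.
  apply: face_sub (face_supp p.1); apply/fintype.subsetP => v; rewrite !inE => h.
  by rewrite gt_eqF // (lt_trans _ h).
apply: face_sub (@face_cone s S sK _).
  apply/fintype.subsetP => v; rewrite inE /push c0 mulr0 addr0 => h.
  rewrite finset.in_setU; have [vs|vs] := boolP (v \in s) => //=.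
  move: h; rewrite (_ : shrink p v = 0) ?mulr0 ?add0r; last first.
    by rewrite /shrink a1 mul1r max_l // subr_le0 leNgt; move: vs; rewrite inE.
  rewrite mulf_eq0 negb_or pnatr_eq0 eqb0 negbK => /andP[/eqP vz].
  rewrite mulf_eq0 negb_or => /andP[_ phi0]; apply/imsetP; exists (pos v) => //.
  by rewrite inE lt0r phi0 phi_ge0.
move=> v; rewrite !inE => vlarge /phi_gt0 vsmall; apply/eqP; apply: contraT => vz.
have := lt_le_trans vlarge (coord_le_mass p.1 vz) => h.
by move: (lt_trans h vsmall); rewrite ltxx.
Qed.

Let continuous_push v : continuous (fun p => push p v).
Proof.
have cfst : continuous (fst : X * R -> X) by move=> [a b]; exact: cvg_fst.
have csnd : continuous (snd : X * R -> R) by move=> [a b]; exact: cvg_snd.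
have cc (a : R) : continuous (fun _ : X * R => a) by exact: cst_continuous.
have cco w : continuous (fun p : X * R => val p.1 w).
  by move=> p; exact: (continuous_comp (cfst p) (@continuous_coord R V K w _)).
have cclamp (f : X * R -> R) : continuous f -> continuous (fun p => clamp (f p)).
  by move=> cf; apply: continuous_minr => //; exact: continuous_maxr.
have cphi i : continuous (fun p : X * R => phi i p.1).
  apply: continuous_maxr => //; apply: continuous_subr => //.
  apply: continuous_mulr => //; exact: continuous_sumr.
have clam : continuous (fun p : X * R => lam p.1) by exact: continuous_sumr.
have c1 : continuous stage1 by apply: cclamp; exact: continuous_mulr.
have c2 : continuous stage2.
  by apply: cclamp; apply: continuous_subr => //; exact: continuous_mulr.
have c3 : continuous stage3.
  apply: cclamp; do 2!(apply: continuous_subr => //); exact: continuous_mulr.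
have cex : continuous excess.
  apply: continuous_maxr => //; apply: continuous_subr => //; exact: continuous_mulr.
apply: continuous_addr; first apply: continuous_addr.
- apply: continuous_mulr; apply: continuous_maxr => //; apply: continuous_subr => //.
    by do 2!(apply: continuous_mulr => //).
  exact: continuous_mulr.
- apply: continuous_mulr => //; apply: continuous_mulr => //.
  apply: continuous_mulr => //; apply: continuous_subr => //.
  by apply: continuous_mulr => //; exact: continuous_minr.
- by apply: continuous_mulr => //; exact: continuous_mulr.
Qed.

(** New weight is put only on vertices [z i], so a vanishing mass stays zero; at time 1 all points
    with a vanishing mass have arrived at the vertex [z ord0]. *)
Lemma collapse_homotopy : {H : X * R -> X | continuous H &
  [/\ forall x, H (x, 0) = x,
      forall x t i, mass i x = 0 -> mass i (H (x, t)) = 0 &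
      forall x y i j, mass i x = 0 -> mass j y = 0 -> H (x, 1) = H (y, 1)]}.
Proof.
have [H cH HE] := realization_normalize push_ge0 sum_push face_push continuous_push.
exists H => //; split=> [x|x t i xi|x y i j xi yj].
- apply: eq_coord => v; rewrite HE.
  have pushE w : push (x, 0) w = val x w.
    rewrite /push /cB /cA /cC /shrink /stage1 /stage2 /stage3 /=.
    have [s1 s2 s3] : [/\ clamp (3 * 0) = 0, clamp (3 * 0 - 1) = 0
        & clamp (3 * 0 - 1 - 1) = 0] by split; apply: clamp_le0E; lra.
    rewrite s1 s2 s3.
    rewrite !mul0r mulr0 !subr0 !mulr0 !addr0 (max_r ler01) mul1r max_r //.
    exact: coord_ge0.
  by under eq_bigr do rewrite pushE; rewrite pushE sum_coord divr1.
- apply/mass_eq0 => v vi vz; rewrite HE; move/mass_eq0: xi => /(_ _ vi vz) xv.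
  rewrite /push /shrink /= xv vi (negPf vz) mul0r.
  have -> : (v == z ord0) = false.
    by apply: contraNF vz => /eqP vE; move: vi; rewrite vE pos_z => <-.
  rewrite mul0r !addr0 sub0r max_l ?mulr0 ?mul0r // oppr_le0 mulr_ge0 //.
    exact: clamp_ge0.
  exact: ltW.
(* A vanishing mass gives [lam >= 1], hence [excess >= 1], so at time 1 both [cA] and [cB] are 0. *)
have HE1 (x' : X) i' : mass i' x' = 0 -> forall v, val (H (x', 1)) v = (v == z ord0)%:R.
  move=> /lam_ge1 l1 v; rewrite HE.
  have pushE w : push (x', 1) w = (w == z ord0)%:R * cC (x', 1).
    rewrite /push /cB /cA /stage2 /stage3 /=.
    rewrite (@clamp_ge1E (3 * 1 - 1)) ?(@clamp_ge1E (3 * 1 - 1 - 1)); try lra.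
    rewrite max_l; last by lra.
    rewrite min_l; last by rewrite /excess /= le_max; apply/orP; right; lra.
    by rewrite mul1r mul0r add0r mul1r subrr mul0r mulr0 add0r.
  have C0 : cC (x', 1) != 0.
    rewrite /cC /stage3 /= (@clamp_ge1E (3 * 1 - 1 - 1)); last by lra.
    by rewrite mul1r /excess gt_eqF // lt_max; apply/orP; right => /=; lra.
  under eq_bigr do rewrite pushE.
  rewrite pushE -mulr_suml (bigD1 (z ord0)) //= eqxx big1 ?addr0 ?mul1r ?mulfK //.
  by move=> w /negPf ->.
by apply: eq_coord => v; rewrite (HE1 _ _ xi) (HE1 _ _ yj).
Qed.

End Collapse.

(** * From a facet to the sphere *)

Lemma bigmin_attained (R : realType) (I : finType) (F : I -> R) (i0 : I) :
  exists i, \big[Num.min/F i0]_i F i = F i.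
Proof.
elim: (index_enum _) => [|i r [j jE]]; first by exists i0; rewrite big_nil.
by rewrite big_cons jE; case: leP => _; [exists i|exists j].
Qed.

Section FacetSphere.
Variables (R : realType) (d : nat) (V : finType) (K : scomplex V).
Variable w : 'I_d.+1 -> V.
Hypothesis w_inj : injective w.
Hypothesis w_max : forall s, face K s -> (forall i, w i \in s) ->
  forall v, v \in s -> exists i, v = w i.

Local Notation X := (realization R K).
Implicit Types x y : X.

(** Positive exactly on the open simplex of the facet [w]. *)
Definition facet_min x : R := \big[Num.min/val x (w ord0)]_i val x (w i).

(* Up to scaling, [(diff x, facet_min x)] identifies the open simplex with
   [R^d * R_(>0)] modulo dilations; the boundary is sent to [facet_min = 0].
   Stereographic projection in these homogeneous coordinates gives the map to
   the sphere; [out] only matters away from the simplex. *)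
Let diff x i : R := val x (w i) - val x (w ord0).
Let out x : R := 1 - \sum_i val x (w i).
Let sqn x : R := \sum_i diff x i ^+ 2 + out x ^+ 2.
Let den x : R := sqn x + facet_min x ^+ 2.

(** Since [diff x ord0] is 0, the slot [ord0] is free for the height. *)
Definition facet_row x : 'rV[R]_d.+1 :=
  \row_i (((i == ord0)%:R * (sqn x - facet_min x ^+ 2) +
           2 * facet_min x * diff x i) / den x).

Lemma facet_min_le x i : facet_min x <= val x (w i).
Proof. exact: bigmin_le. Qed.

Lemma facet_min_eq x : exists i, facet_min x = val x (w i).
Proof. exact: bigmin_attained. Qed.

Lemma facet_min_ge0 x : 0 <= facet_min x.
Proof. by have [i ->] := facet_min_eq x; exact: coord_ge0. Qed.

Lemma coord_off_facet x v : facet_min x != 0 -> (forall i, v != w i) ->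
  val x v = 0.
Proof.
move=> x0 vw; apply/eqP; apply: contraT => xv.
have [||i vE] := w_max (face_supp x) _ (v := v).
- move=> i; rewrite inE gt_eqF // (lt_le_trans _ (facet_min_le x i)) //.
  by rewrite lt0r x0 facet_min_ge0.
- by rewrite inE.
by move: (vw i); rewrite vE eqxx.
Qed.

Let sum_facet x : facet_min x != 0 -> \sum_i val x (w i) = 1.
Proof.
move=> x0; rewrite -[RHS](sum_coord x) (bigID (mem (w @: finset.setT))) /=.
rewrite [X in _ + X]big1 ?addr0.
  rewrite big_imset /=; last by move=> i j _ _; exact: w_inj.
  by apply: eq_bigl => i; rewrite inE.
move=> v /imsetP vw; apply: coord_off_facet => // i.
by apply/eqP => vE; apply: vw; exists i.
Qed.

Let out_eq0 x : facet_min x != 0 -> out x = 0.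
Proof. by move=> x0; rewrite /out sum_facet // subrr. Qed.

Let diff0 x : diff x ord0 = 0. Proof. exact: subrr. Qed.

Let sqn_ge0 x : 0 <= sqn x.
Proof. by rewrite addr_ge0 ?sqr_ge0 // sumr_ge0 // => i _; exact: sqr_ge0. Qed.

(** If [den] vanished, all facet coordinates would equal their minimum 0, and [out] would be 1
    instead of 0. *)
Let den_gt0 x : 0 < den x.
Proof.
rewrite lt0r addr_ge0 ?sqr_ge0 // andbT paddr_eq0 ?sqr_ge0 //.
apply/negP => /andP[sq0 /eqP/eqP]; rewrite sqrf_eq0 => /eqP m0.
move: sq0; rewrite paddr_eq0 ?sqr_ge0 //; last first.
  by rewrite sumr_ge0 // => i _; exact: sqr_ge0.
rewrite sqrf_eq0 => /andP[/eqP/psumr_eq0P d0 /eqP].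
have {}d0 i : val x (w i) = val x (w ord0).
  apply/eqP; rewrite -subr_eq0 -sqrf_eq0; apply/eqP/d0 => // j _; exact: sqr_ge0.
have [j] := facet_min_eq x; rewrite m0 d0 => x0.
rewrite /out big1 => [|i _]; last by rewrite d0.
by rewrite subr0 => /eqP; rewrite oner_eq0.
Qed.

Let sum_diff x : facet_min x != 0 -> \sum_i diff x i ^+ 2 = sqn x.
Proof. by move=> x0; rewrite /sqn out_eq0 // expr0n addr0. Qed.

Lemma facet_row_sphere x : sphere_set (facet_row x).
Proof.
rewrite /sphere_set /=.
have dE i : (facet_row x) 0 i ^+ 2 =
  ((i == ord0)%:R * (sqn x - facet_min x ^+ 2) ^+ 2 +
   4 * facet_min x ^+ 2 * diff x i ^+ 2) / den x ^+ 2.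
  rewrite mxE; have [->|i0] := eqVneq i ord0.
    by rewrite diff0 !mul1r; field; exact: lt0r_neq0.
  by rewrite !mul0r; field; exact: lt0r_neq0.
rewrite (eq_bigr _ (fun i _ => dE i)) -mulr_suml big_split /= -mulr_sumr.
rewrite (bigD1 ord0) //= big1 ?addr0; last first.
  by move=> i /negPf ->; rewrite mul0r.
apply: (canLR (mulfK _)); first by rewrite expf_neq0 // lt0r_neq0.
(* On the boundary the factor [facet_min x] removes the squares of [diff], whose sum may differ from
   [sqn] there. *)
have [m0|m0] := eqVneq (facet_min x) 0; rewrite /den.
  by rewrite m0; ring.
by rewrite sum_diff //; ring.
Qed.

Definition facet_sphere x : sphere R d :=
  exist _ (facet_row x) (mem_set (facet_row_sphere x)).

Lemma continuous_facet_min : continuous facet_min.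
Proof.
by apply: continuous_bigminr => [|i]; exact: continuous_coord.
Qed.

Lemma continuous_facet_sphere : continuous facet_sphere.
Proof.
apply: continuous_set_type; apply: continuous_mx => i j /=.
have cc (a : R) : continuous (fun _ : X => a) by exact: cst_continuous.
have cdiff k : continuous (fun x => diff x k).
  by apply: continuous_subr; exact: continuous_coord.
have cm2 : continuous (fun x => facet_min x ^+ 2).
  by apply: continuous_mulr; exact: continuous_facet_min.
have cout : continuous out.
  by apply: continuous_subr => //; apply: continuous_sumr => k; exact: continuous_coord.
have csqn : continuous sqn.
  apply: continuous_addr; last exact: continuous_mulr.
  by apply: continuous_sumr => k; exact: continuous_mulr.
rewrite (_ : (fun _ => _) = fun x =>
  ((j == ord0)%:R * (sqn x - facet_min x ^+ 2) +
   2 * facet_min x * diff x j) / den x); last by apply/funext => x; rewrite mxE.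
apply: continuous_divr => [x||]; first exact: lt0r_neq0.
  apply: continuous_addr; apply: continuous_mulr => //; first exact: continuous_subr.
  apply: continuous_mulr => //; exact: continuous_facet_min.
exact: continuous_addr.
Qed.

Let facet_row0 x : facet_row x 0 ord0 = 1 - 2 * (facet_min x ^+ 2 / den x).
Proof.
rewrite mxE diff0 eqxx mul1r mulr0 addr0; apply: (canLR (mulfK _)).
  exact: lt0r_neq0.
rewrite mulrBl mul1r -!mulrA mulVf ?lt0r_neq0 // mulr1 /den; ring.
Qed.

Lemma facet_sphere_eq_base x : facet_sphere x = sphere_base R d <-> facet_min x = 0.
Proof.
split=> [/(congr1 val) /= /matrixP/(_ ord0 ord0)|m0].
  rewrite facet_row0 mxE !eqxx /= => h; apply/eqP; rewrite -sqrf_eq0.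
  have : facet_min x ^+ 2 / den x = 0 by lra.
  by move/eqP; rewrite mulf_eq0 invr_eq0 (gt_eqF (den_gt0 x)) orbF.
apply/val_inj/rowP => i; rewrite /= !mxE /den m0 expr0n /= mulr0 mul0r subr0 !addr0 /=.
by rewrite mulfK // gt_eqF //; have := den_gt0 x; rewrite /den m0 expr0n addr0.
Qed.

Lemma facet_sphere_inj x y : facet_min x != 0 -> facet_min y != 0 ->
  facet_sphere x = facet_sphere y -> x = y.
Proof.
move=> x0 y0 /(congr1 val) /= xy.
have dx := lt0r_neq0 (den_gt0 x); have dy := lt0r_neq0 (den_gt0 y).
have e0 : facet_min x ^+ 2 * den y = facet_min y ^+ 2 * den x.
  have /(congr1 (fun r : 'rV_d.+1 => r 0 ord0)) := xy; rewrite !facet_row0 => h.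
  apply/eqP; rewrite -eqr_div //; apply/eqP; lra.
have prop i : facet_min y * diff x i = facet_min x * diff y i.
  have [->|i0] := eqVneq i ord0; first by rewrite !diff0 !mulr0.
  have /(congr1 (fun r : 'rV_d.+1 => r 0 i)) := xy.
  rewrite !mxE (negPf i0) !mul0r !add0r => /eqP; rewrite eqr_div // => /eqP h.
  apply: (mulfI (mulf_neq0 x0 dy)).
  transitivity (2^-1 * facet_min y * (2 * facet_min x * diff x i * den y)); first by field.
  rewrite h; transitivity (diff y i * (facet_min y ^+ 2 * den x)); first by field.
  by rewrite -e0; ring.
(* The scaled coordinates of [x] and [y] differ by a constant [c]; comparing at an index of minimum
   of [x] and at one of [y] gives [c <= 0] and [c >= 0]. *)
pose c := facet_min y * val x (w ord0) - facet_min x * val y (w ord0).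
have cE i : facet_min y * val x (w i) = facet_min x * val y (w i) + c.
  by have := prop i; rewrite /diff /c; lra.
have mx : 0 < facet_min x by rewrite lt0r x0 facet_min_ge0.
have my : 0 < facet_min y by rewrite lt0r y0 facet_min_ge0.
have c0 : c = 0.
  apply/eqP; rewrite eq_le; apply/andP; split.
    have [i iE] := facet_min_eq x; have := cE i; rewrite -iE.
    have := facet_min_le y i; rewrite -(ler_pM2l mx); lra.
  have [i iE] := facet_min_eq y; have := cE i; rewrite -iE.
  have := facet_min_le x i; rewrite -(ler_pM2l my); lra.
have {}cE i : facet_min y * val x (w i) = facet_min x * val y (w i).
  by rewrite cE c0 addr0.
have mxy : facet_min y = facet_min x.
  have : \sum_i facet_min y * val x (w i) = \sum_i facet_min x * val y (w i).
    by apply: eq_bigr.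
  by rewrite -!mulr_sumr !sum_facet // !mulr1.
apply: eq_coord => v.
have [[i ->]|/forallNP vw] := pselect (exists i, v = w i).
  by apply: (mulfI y0); rewrite cE mxy.
by rewrite !coord_off_facet // => i; apply/eqP/vw.
Qed.

Hypothesis w_face : face K (w @: finset.setT).

Lemma facet_sphere_surj (s : sphere R d) : s <> sphere_base R d ->
  exists2 x, facet_min x != 0 & facet_sphere x = s.
Proof.
case: s => s sS; have /set_mem := sS; rewrite /sphere_set /= => ns sb.
pose a := s 0 ord0; pose b := \sum_(i < d.+1 | i != ord0) s 0 i ^+ 2.
have abE : a ^+ 2 + b = 1 by rewrite -ns (bigD1 ord0).
have b0 : 0 <= b by rewrite sumr_ge0 // => i _; exact: sqr_ge0.
have a1 : a != 1.
  apply/eqP => a1; apply: sb; apply/val_inj/rowP => i; rewrite /= mxE eqxx /=.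
  have [->//|i0] := eqVneq i ord0.
  have /psumr_eq0P s0 : b = 0 by move: abE; rewrite a1 expr1n; lra.
  by apply/eqP; rewrite -sqrf_eq0; apply/eqP/s0 => // j _; exact: sqr_ge0.
have a1' : 1 - a != 0 by rewrite subr_eq0 eq_sym.
(* Stereographic projection from the base point. *)
pose om i : R := if i == ord0 then 0 else s 0 i / (1 - a).
have om0 : om ord0 = 0 by rewrite /om eqxx.
pose m := \big[Num.min/om ord0]_i om i.
have m_le i : m <= om i by exact: bigmin_le.
have [i0 m_eq] : exists i, m = om i by exact: bigmin_attained.
(* Shifted so that the least weight is 1: after division by [T], [diff] and [facet_min] are [om] and
   1, both divided by [T]. *)
pose W i := om i - m + 1; pose T := \sum_i W i.
have W1 i : 1 <= W i by rewrite /W; have := m_le i; lra.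
have T0 : 0 < T.
  rewrite /T (bigD1 ord0) //= ltr_wpDr //; last by have := W1 ord0; lra.
  by apply: sumr_ge0 => i _; have := W1 i; lra.
pose u (v : V) : R := (\sum_(i | w i == v) W i) / T.
have uw i : u (w i) = W i / T.
  by rewrite /u (eq_bigl (pred1 i)) ?big_pred1_eq // => j /=; rewrite inj_eq.
have u_off v : (forall i, v != w i) -> u v = 0.
  move=> vw; rewrite /u big1 ?mul0r // => i /eqP iv.
  by move: (vw i); rewrite iv eqxx.
have uX : (u : {ptws V -> R}) \in realization_set (R := R) K.
  apply/mem_set; split=> [v||].
  - apply: divr_ge0; last exact: ltW.
    by apply: sumr_ge0 => i _; have := W1 i; lra.
  - rewrite -mulr_suml; apply: (canLR (mulfK _)); first exact: lt0r_neq0.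
    rewrite mul1r /T (exchange_big_dep xpredT) //=; apply: eq_bigr => i _.
    by rewrite (eq_bigl (pred1 (w i))) ?big_pred1_eq // => v /=; rewrite eq_sym.
  - apply: face_sub w_face; apply/fintype.subsetP => v; rewrite inE => uv.
    apply: contraT => /imsetP vw; move: uv; rewrite u_off ?eqxx // => i.
    by apply/eqP => vE; apply: vw; exists i.
pose x : X := exist _ (u : {ptws V -> R}) uX.
have xw i : val x (w i) = W i / T by exact: uw.
have mE : facet_min x = T^-1.
  apply/eqP; rewrite eq_le; apply/andP; split.
    by apply: le_trans (facet_min_le x i0) _; rewrite xw /W m_eq subrr add0r mul1r.
  have [j ->] := facet_min_eq x; rewrite xw ler_peMl //.
  by rewrite invr_ge0 ltW.
have m0 : facet_min x != 0 by rewrite mE invr_eq0 lt0r_neq0.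
have T0' := lt0r_neq0 T0.
exists x => //; apply/val_inj/rowP => i /=.
have dE j : diff x j = om j / T.
  by rewrite /diff !xw /W om0; field.
pose N := \sum_j om j ^+ 2.
have sE : sqn x = N / T ^+ 2.
  rewrite -sum_diff // mulr_suml; apply: eq_bigr => j _.
  by rewrite dE expr_div_n.
have NE : N * (1 - a) = 1 + a.
  rewrite /N (bigD1 ord0) //= om0 expr0n add0r.
  rewrite (eq_bigr (fun j => s 0 j ^+ 2 / (1 - a) ^+ 2)); last first.
    by move=> j /negPf j0; rewrite /om j0 expr_div_n.
  rewrite -mulr_suml -/b (_ : b = (1 - a) * (1 + a)); last by move: abE; lra.
  by field.
have N0 : 0 <= N by rewrite sumr_ge0 // => j _; exact: sqr_ge0.
have N1 : N + 1 != 0 by rewrite gt_eqF //; lra.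
rewrite mxE /den sE mE dE.
have -> : N / T ^+ 2 + T^-1 ^+ 2 = (N + 1) / T ^+ 2 by field.
have [->|i1] := eqVneq i ord0.
  rewrite om0 mul1r.
  transitivity ((N - 1) / (N + 1)); first by field; rewrite N1.
  apply: (canLR (mulfK _)) => //; rewrite -/a; move: NE; lra.
rewrite {1}/om (negPf i1) mul0r add0r.
transitivity (2 * s 0 i / ((N + 1) * (1 - a))); first by field; rewrite N1 a1'.
rewrite [(N + 1) * _]mulrDl NE mul1r (_ : 1 + a + (1 - a) = 2); last by ring.
by field.
Qed.

End FacetSphere.

(** * The wedge *)

Lemma sphere_hausdorff (R : realType) d : hausdorff_space (sphere R d).
Proof. by apply: hausdorff_set_type; exact: norm_hausdorff. Qed.

Section CliqueComplex.
Variables (R : realType) (d : nat) (V : finType) (K : scomplex V).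
Variables (pos : V -> 'I_d.+1) (z : 'I_d.+1 -> V).
Hypothesis pos_z : cancel z pos.
Hypothesis pos_inj : forall s, face K s -> {in s &, injective pos}.
Hypothesis face_cone : forall s (S : {set 'I_d.+1}), face K s ->
  (forall v, v \in s -> pos v \in S -> v = z (pos v)) -> face K (s :|: z @: S)%SET.

Local Notation X := (realization R K).
Implicit Types x y : X.

(** * Collapse onto an abstract wedge of spheres *)

Section Target.
Variables (J : finType) (w : J -> {ffun 'I_d.+1 -> V}).
Hypothesis w_inj : injective w.
Hypothesis w_free : forall j, free_facet K pos z (w j).
Hypothesis w_all : forall u, free_facet K pos z u -> exists j, w j = u.

Let pos_w j i : pos (w j i) = i.
Proof. by have /andP[/forallP/(_ i)/andP[/eqP]] := w_free j. Qed.

Let w_neq j i : w j i != z i.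
Proof. by have /andP[/forallP/(_ i)/andP[]] := w_free j. Qed.

Let w_face j : face K (w j @: finset.setT).
Proof. by have /andP[] := w_free j. Qed.

Let wj_inj j : injective (w j).
Proof. exact: (can_inj (pos_w j)). Qed.

Let w_max j s : face K s -> (forall i, w j i \in s) ->
  forall v, v \in s -> exists i, v = w j i.
Proof.
move=> sK ws v vs; exists (pos v); apply: (pos_inj sK) => //; rewrite pos_w.
Qed.

Let facet_min_mass j x i : mass pos z i x = 0 -> facet_min (w j) x = 0.
Proof.
move=> /mass_eq0/(_ (w j i) (pos_w j i) (w_neq j i)) x0.
by apply/eqP; rewrite eq_le facet_min_ge0 andbT -x0 facet_min_le.
Qed.

Let facet_min_uniq x j j' :
  facet_min (w j) x != 0 -> facet_min (w j') x != 0 -> j = j'.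
Proof.
move=> jx j'x; apply: w_inj; apply/ffunP => i.
apply: (pos_inj (face_supp x)); last by rewrite !pos_w.
- rewrite inE gt_eqF // (lt_le_trans _ (facet_min_le (w j) x i)) //.
  by rewrite lt0r jx facet_min_ge0.
- rewrite inE gt_eqF // (lt_le_trans _ (facet_min_le (w j') x i)) //.
  by rewrite lt0r j'x facet_min_ge0.
Qed.

(** Choosing in each position a letter of the support other than [z i] gives a free facet. *)
Let exists_facet x : (forall i, mass pos z i x != 0) ->
  exists j, facet_min (w j) x != 0.
Proof.
move=> x0.
have /choice[u uP] : forall i, exists v, [/\ pos v = i, v != z i & val x v != 0].
  move=> i; apply: contrapT => /forallNP h; move/eqP: (x0 i); apply.
  by apply/mass_eq0 => v vi vz; apply/eqP; apply: contraT => xv; case: (h v).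
have [|j jE] := w_all (u := finfun u).
  apply/andP; split.
    by apply/forallP => i; rewrite ffunE; have [-> -> _] := uP i; rewrite eqxx.
  apply: face_sub (face_supp x); apply/fintype.subsetP => v /imsetP[i _ ->].
  by rewrite inE ffunE; have [] := uP i.
exists j; have [i ->] := facet_min_eq (w j) x.
by rewrite jE ffunE; have [] := uP i.
Qed.

Variables (W : topologicalType) (b : W) (io : J -> sphere R d -> W).
Hypothesis W_hausdorff : hausdorff_space W.
Hypothesis io_continuous : forall j, continuous (io j).
Hypothesis io_base : forall j, io j (sphere_base R d) = b.
Hypothesis io_eq_base : forall j s, io j s = b -> s = sphere_base R d.
Hypothesis io_inj : forall j j' s s', s <> sphere_base R d ->
  io j s = io j' s' -> j = j' /\ s = s'.
Hypothesis io_surj : forall p, p = b \/ exists j s, p = io j s.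

Let sph j x : sphere R d := facet_sphere (@wj_inj j) (@w_max j) x.

Let collapse x : W :=
  if [pick j | facet_min (w j) x != 0] is Some j then io j (sph j x) else b.

Let collapseE j x : facet_min (w j) x != 0 -> collapse x = io j (sph j x).
Proof.
move=> jx; rewrite /collapse; case: pickP => [j' j'x|/(_ j)]; last by rewrite jx.
by rewrite (facet_min_uniq jx j'x).
Qed.

Let collapse0 x : (forall j, facet_min (w j) x = 0) -> collapse x = b.
Proof. by move=> x0; rewrite /collapse; case: pickP => // j; rewrite x0 eqxx. Qed.

Let continuous_sph j : continuous (fun x => io j (sph j x)).
Proof.
have cs := @continuous_facet_sphere R d V K (w j) (@wj_inj j) (@w_max j).
by move=> x; exact: (continuous_comp (cs x) (@io_continuous j _)).
Qed.

(** In an open free facet the chosen [j] is locally constant. Elsewhere each of the finitely many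
    maps [io j (sph j x)] takes the value [b], and their neighbourhoods are intersected. *)
Let continuous_collapse : continuous collapse.
Proof.
move=> x U nU; suff : \forall y \near x, U (collapse y) by [].
have [[j jx]|/forallNP xN] := pselect (exists j, facet_min (w j) x != 0).
  rewrite (collapseE jx) in nU.
  have n0 : nbhs (facet_min (w j) x) [set a : R | a != 0].
    by apply: open_nbhs_nbhs; split=> //; exact: open_neq.
  have n1 : \forall y \near x, facet_min (w j) y != 0.
    exact: (@continuous_facet_min R d V K (w j) x _ n0).
  have n2 : \forall y \near x, U (io j (sph j y)) by exact: (@continuous_sph j x _ nU).
  by apply: filterS2 n1 n2 => y jy Uy; rewrite (collapseE jy).
have {}xN j : facet_min (w j) x = 0 by apply/eqP/negPn/negP/xN.
rewrite (collapse0 xN) in nU.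
have nj j : \forall y \near x, U (io j (sph j y)).
  apply: (@continuous_sph j x U).
  rewrite (_ : sph j x = sphere_base R d) ?io_base //.
  exact/facet_sphere_eq_base.
have : \forall y \near x, forall j, U (io j (sph j y)).
  exact: (@filter_forall _ _ _ (nbhs x) (@nbhs_filter X x) nj).
apply: filterS => y Uy.
have [[j jy]|/forallNP yN] := pselect (exists j, facet_min (w j) y != 0).
  by rewrite (collapseE jy).
rewrite collapse0 => [|j]; last by apply/eqP/negPn/negP/yN.
exact: nbhs_singleton.
Qed.

Let collapse_eq x y : collapse x = collapse y ->
  x = y \/ (exists i, mass pos z i x = 0) /\ (exists i, mass pos z i y = 0).
Proof.
have dec x' : (exists i, mass pos z i x' = 0) \/ exists j, facet_min (w j) x' != 0.
  have [|/forallNP xN] := pselect (exists i, mass pos z i x' = 0); first by left.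
  by right; apply: exists_facet => i; apply/eqP/xN.
have cK x' i : mass pos z i x' = 0 -> collapse x' = b.
  by move=> /facet_min_mass x'0; apply: collapse0.
have [[i xi]|[j jx]] := dec x; have [[i' yi]|[j' jy]] := dec y.
- by move=> _; right; split; [exists i|exists i'].
- rewrite (cK _ _ xi) (collapseE jy) => /esym/io_eq_base/facet_sphere_eq_base.
  by move/eqP: jy.
- rewrite (cK _ _ yi) (collapseE jx) => /io_eq_base/facet_sphere_eq_base.
  by move/eqP: jx.
- rewrite (collapseE jx) (collapseE jy) => /io_inj[].
    by move/facet_sphere_eq_base; move/eqP: jx.
  move=> jj'; move: jy; rewrite -jj' => jy /facet_sphere_inj xy; left; exact: xy.
Qed.

Let collapse_surj p : exists x, collapse x = p.
Proof.
have base : exists x, collapse x = b.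
  pose u (v : V) : R := (v == z ord0)%:R.
  have uX : (u : {ptws V -> R}) \in realization_set (R := R) K.
    apply/mem_set; split=> [v||]; first exact: ler0n.
      by rewrite (bigD1 (z ord0)) //= big1 /u ?eqxx ?addr0 // => v /negPf ->.
    apply: face_sub (face_vertex K (z ord0)); apply/fintype.subsetP => v.
    by rewrite !inE pnatr_eq0 eqb0 negbK.
  exists (exist _ (u : {ptws V -> R}) uX); apply: collapse0 => j.
  apply: (@facet_min_mass j _ ord0); apply/mass_eq0 => v _ vz.
  by rewrite /= /u (negPf vz).
have [->//|[j [s ->]]] := io_surj p.
have [->|sb] := pselect (s = sphere_base R d); first by rewrite io_base.
have [x jx xs] := facet_sphere_surj (@wj_inj j) (@w_max j) (@w_face j) sb.
by exists x; rewrite (collapseE jx) /sph xs.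
Qed.

(** The fibres of [collapse] are single points and the subcomplex where some mass vanishes; the
    homotopy preserves the latter and ends constant on it. An abstract [W] covers the one-point case
    as well. *)
Lemma clique_complex_collapse : homotopy_equivalent R X W.
Proof.
have [H cH [H0 HK H1]] := collapse_homotopy R pos_z pos_inj face_cone.
have /choice[s sK] := collapse_surj.
apply: (homotopy_equivalent_collapse (f := collapse) (s := s) (H := H)) => //.
- exact: compact_realization.
- move=> x t; have [->//|[[i si] [i' xi]]] := collapse_eq (sK (collapse x)).
  rewrite [LHS]collapse0 ?[RHS]collapse0 // => j; first exact: facet_min_mass (HK _ _ _ xi).
  exact: facet_min_mass (HK _ _ _ si).
- move=> x; have [->//|[[i si] [i' xi]]] := collapse_eq (sK (collapse x)).
  exact: H1 si xi.
Qed.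

End Target.

Theorem clique_complex_wedge :
  homotopy_equivalent R X
    (wedge_copies #|[pred w | free_facet K pos z w]| (sphere_base R d)).
Proof.
set P := [pred w | free_facet K pos z w].
have [w [w_inj w_free w_all]] : exists w : 'I_#|P| -> {ffun 'I_d.+1 -> V},
    [/\ injective w, forall j, free_facet K pos z (w j) &
        forall u, free_facet K pos z u -> exists j, w j = u].
  exists enum_val; split=> [|j|u uP]; first exact: enum_val_inj.
    exact: (enum_valP j).
  by exists (enum_rank_in (A := P) uP u); rewrite enum_rankK_in.
case: #|P| w w_inj w_free w_all => [|n] w w_inj w_free w_all.
  apply: (clique_complex_collapse w_inj w_free w_all
    (W := discrete_topology unit) (b := tt) (io := fun _ _ => tt)) => //; try by case.
  - exact: discrete_hausdorff.
  - by case; left.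
pose bas (_ : 'I_n.+1) := sphere_base R d.
(* Points of the wedge are compared in the product of the spheres, where a point of the [j]-th
   sphere has base coordinates away from [j]. *)
have liftE j j' (s s' : sphere R d) :
    @wedge_lift _ _ bas j s = @wedge_lift _ _ bas j' s' ->
    (j = j' /\ s = s') \/ (s = sphere_base R d /\ s' = sphere_base R d).
  move=> /(congr1 (@wedge_prod _ _ bas)).
  rewrite /wedge_prod !wedge_lift_funE; try exact: wedge_prod_pointE.
  move=> E; have [jj'|jj'] := eqVneq j j'.
    by left; move: E; rewrite -jj' => /(congr1 (fun f => f j)); rewrite !dfwithin.
  right; split.
    by have := congr1 (fun f => f j) E; rewrite dfwithin dfwithout // eq_sym.
  by have := congr1 (fun f => f j') E; rewrite dfwithin dfwithout.
apply: (clique_complex_collapse w_inj w_free w_all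
  (b := @wedge_lift _ _ bas ord0 (sphere_base R d))
  (io := fun j s => @wedge_lift _ _ bas j s)).
- by apply: wedge_hausdorff => _; exact: sphere_hausdorff.
- by move=> j; exact: (@wedge_lift_continuous _ _ bas j).
- by move=> j; exact: (@wedge_liftE _ _ bas ord0 (sphere_base R d) j (sphere_base R d)).
- by move=> j s /liftE[[_]|[]].
- by move=> j j' s s' sb /liftE[//|[/sb]].
- move=> p; right; have : [set: wedge bas] p by [].
  by rewrite -wedgeTE => -[j _ [s _ <-]]; exists j, s.
Qed.

End CliqueComplex.

Theorem theorem5p16 (R : realType) (k : nat) (m : 'I_k -> nat)
    (k_ge1 : (1 <= k)%N) (m_ge1 : forall i : 'I_k, (1 <= m i)%N) :
  homotopy_equivalent R
    (realization R (matching_complex (graph_a m)))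
    (wedge_copies (Lpoly (fun i => m i - 1)%N) (sphere_base R k.-1)).
Proof.
case: k m k_ge1 m_ge1 => // d m _ m_gt0.
have [le leP] := exists_leaf_edge m.
(* [inord] extends the weights [m i - 1] to all natural indices. *)
rewrite (@Lpoly_word_sum _ _ (fun p => m (inord p) - 1)%N); last first.
  by move=> i; rewrite inord_val.
rewrite -(card_free_facet m_gt0 leP) /=.
apply: clique_complex_wedge.
- exact: pos_base_leg.
- exact: matching_pos_inj.
- exact: matching_cone.
Qed.
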